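(* Let $p \ge 3$ be an integer, let $f, g_1, \ldots, g_l, h_1, \ldots, h_m \colon \mathbb{R}^n \to \mathbb{R}$ be definable $C^p$-functions, and assume that $$S := \{x \in \mathbb{R}^n \mid g_1(x) \ge 0, \ldots, g_l(x) \ge 0,\ h_1(x) = 0, \ldots, h_m(x) = 0\} \ne \emptyset.$$ Assume that $f_* := \min_{x \in S} f(x) > -\infty$. If at every minimizer of the restriction of $f$ to $S$ the set $S$ is regular and the strict complementarity and second-order sufficiency conditions hold, then there are definable $C^{p-2}$-functions $\phi_i, \psi_j \colon \mathbb{R}^n \to \mathbb{R}$ for $i = 0, \ldots, l$ and $j = 1, \ldots, m$, where each $\phi_i$ is a sum of squares of definable $C^{p-2}$-functions, such that on $\mathbb{R}^n$ $$f - f_* = \phi_0 + \sum_{i=1}^l \phi_i g_i + \sum_{j=1}^m \psi_j h_j.$$ Moreover, with such functions $\phi_i, \psi_j$, let $x^* \in S$ be a global minimizer of $f$ on $S$. Then the following statements hold: (i) $\phi_0(x^* ) = 0$, and $\phi_i(x^* ) g_i(x^* ) = 0$ and $\phi_i(x^* ) \ge 0$ for all $i = 1, \ldots, l$. (ii) $\nabla f(x^* ) - \sum_{i=1}^l \phi_i(x^* ) \nabla g_i(x^* ) - \sum_{j=1}^m \psi_j(x^* ) \nabla h_j(x^* ) = 0$. (iii) $x^*$ is a global minimizer (over $\mathbb{R}^n$) of the (generalized) Lagrangian function $$\mathscr{L}(x) := f(x) - f_* - \sum_{i=1}^l \phi_i(x) g_i(x) - \sum_{j=1}^m \psi_j(x)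 h_j(x).$$
   Context: An o-minimal structure on $(\mathbb{R}, +, \cdot)$ is a sequence $\mathcal{D} = (\mathcal{D}_n)_{n \in \mathbb{N}}$ such that for each $n$: (a) $\mathcal{D}_n$ is a Boolean algebra of subsets of $\mathbb{R}^n$; (b) if $X \in \mathcal{D}_m$ and $Y \in \mathcal{D}_n$ then $X \times Y \in \mathcal{D}_{m+n}$; (c) if $X \in \mathcal{D}_{n+1}$ then $\pi(X) \in \mathcal{D}_n$, where $\pi \colon \mathbb{R}^{n+1} \to \mathbb{R}^n$ is the projection on the first $n$ coordinates; (d) $\mathcal{D}_n$ contains all algebraic subsets of $\mathbb{R}^n$; (e) each set in $\mathcal{D}_1$ is a finite union of points and intervals. Fix an o-minimal structure on $(\mathbb{R}, +, \cdot)$; ''definable'' means belonging to this structure, and a mapping is definable if its graph is a definable set. ''Sum of squares'' means a finite sum of squares; the functions being squared have the same domain as $\phi_i$. For $x \in S$, let $I(x) := \{i \in \{1, \ldots, l\} \mid g_i(x) = 0\}$ (the active constraint indices). $S$ is regular at $x \in S$ if the gradient vectors $\nabla g_i(x)$, $i \in I(x)$, and $\nabla h_j(x)$, $j = 1, \ldots, m$, are linearly independent. If $x^*$ is a local minimizer of the restriction of $f$ to $S$ and $S$ is regular at $x^*$, there exist unique Lagrange multipliers $\lambda_1, \ldots, \lambda_l, \nu_1, \ldots, \nu_m \in \mathbb{R}$ satisfying the KKT optimality conditions $$\nabla f(x^* ) - \sum_{i=1}^l \lambda_i \nabla g_i(x^* ) - \sum_{j=1}^m \nu_j \nabla h_j(x^*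 ) = 0, \qquad \lambda_i g_i(x^* ) = 0,\ \lambda_i \ge 0 \ \text{ for } i = 1, \ldots, l.$$ With these multipliers: The strict complementarity condition holds at $x^*$ if $\lambda_i + g_i(x^* ) > 0$ for all $i = 1, \ldots, l$ (equivalently, $\lambda_i > 0$ for every $i \in I(x^* )$). Let $L(x) := f(x) - \sum_{i \in I(x^* )} \lambda_i g_i(x) - \sum_{j=1}^m \nu_j h_j(x)$ and $$T_{x^*}S := \{v \in \mathbb{R}^n \mid \langle v, \nabla g_i(x^* ) \rangle = 0 \text{ for } i \in I(x^* ), \ \langle v, \nabla h_j(x^* ) \rangle = 0 \text{ for } j = 1, \ldots, m\}.$$ The second-order sufficiency condition holds at $x^*$ if $v^T \nabla^2 L(x^* ) v > 0$ for all $v \in T_{x^*}S \setminus \{0\}$, where $\nabla^2 L(x^* )$ is the Hessian matrix of $L$ at $x^*$. ''Minimizer of the restriction of $f$ to $S$'' means a global minimizer of $f$ on $S$, i.e. a point $x^* \in S$ with $f(x^* ) = f_*$. *)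

(* Defs.v *)
From mathcomp Require Import all_boot all_order all_algebra.
From mathcomp Require Import all_classical all_reals all_analysis.
(* Not imported: its notations clash with those of MathComp-Analysis. *)
From mathcomp Require mpoly.

Set Implicit Arguments.
Unset Strict Implicit.
Unset Printing Implicit Defensive.

Import Order.TTheory GRing.Theory Num.Theory.
Import numFieldNormedType.Exports.
Local Open Scope classical_set_scope.
Local Open Scope ring_scope.

(* Points of R^n are row vectors, and R^m x R^n is identified with R^(m + n).
   By Hilbert's basis theorem, finitely many equations are enough to describe
   an algebraic set. *)
Definition algebraic_set (R : realType) (n : nat) (X : set 'rV[R]_n) : Prop :=
  exists (N : nat) (P : 'I_N -> mpoly.mpoly n R),
    X = [set x | forall r, mpoly.meval (fun i => x 0 i) (P r) = 0].

(* Intervals may be open, closed, half-open or unbounded; points are the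
   degenerate ones [a, a]. *)
Definition finite_union_of_intervals (R : realType) (X : set 'rV[R]_1) : Prop :=
  exists s : seq (interval R),
    X = [set x | exists2 J, J \in s & x 0 0 \in J].

Record o_minimal_structure (R : realType) := OMinimalStructure {
  definable : forall n : nat, set (set 'rV[R]_n);
  definableT : forall n, definable (setT : set 'rV[R]_n);
  definableC : forall n (X : set 'rV[R]_n), definable X -> definable (~` X);
  definableU : forall n (X Y : set 'rV[R]_n),
    definable X -> definable Y -> definable (X `|` Y);
  definableX : forall m n (X : set 'rV[R]_m) (Y : set 'rV[R]_n),
    definable X -> definable Y ->
    definable [set z : 'rV[R]_(m + n) | X (lsubmx z) /\ Y (rsubmx z)];
  definable_proj : forall n (X : set 'rV[R]_(n + 1)),
    definable X -> definable [set lsubmx z | z in X];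
  definable_algebraic : forall n (X : set 'rV[R]_n),
    algebraic_set X -> definable X;
  definable1 : forall X : set 'rV[R]_1,
    definable X -> finite_union_of_intervals X
}.

Definition definable_fun (R : realType) (D : o_minimal_structure R) (n : nat)
    (f : 'rV[R]_n -> R) : Prop :=
  definable D [set z : 'rV[R]_(n + 1) | rsubmx z 0 0 = f (lsubmx z)].

Definition partial (R : realType) (n : nat) (i : 'I_n) (f : 'rV[R]_n -> R)
    (x : 'rV[R]_n) : R :=
  'D_(delta_mx 0 i) f x.

(* f is of class C^k: all iterated partial derivatives of order at most k exist
   everywhere and are continuous.  'D is a total operator, so the existence of
   the partial derivatives has to be required separately. *)
Fixpoint class_C (R : realType) (n : nat) (k : nat) (f : 'rV[R]_n -> R) : Prop :=
  continuous f /\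
  match k with
  | 0%N => True
  | k'.+1 => forall i : 'I_n,
      (forall x, derivable f x (delta_mx 0 i)) /\ class_C k' (partial i f)
  end.

Definition gradient (R : realType) (n : nat) (f : 'rV[R]_n -> R)
    (x : 'rV[R]_n) : 'rV[R]_n :=
  \row_i partial i f x.

Definition hessian (R : realType) (n : nat) (f : 'rV[R]_n -> R)
    (x : 'rV[R]_n) : 'M[R]_n :=
  \matrix_(i, j) partial i (partial j f) x.

Definition dot (R : realType) (n : nat) (u v : 'rV[R]_n) : R :=
  (u *m v^T) 0 0.

(* In all that follows, g : 'I_l -> _ are the inequality constraints g_i >= 0
   and h : 'I_m -> _ the equality constraints h_j = 0. *)
Definition feasible (R : realType) (n l m : nat)
    (g : 'I_l -> 'rV[R]_n -> R) (h : 'I_m -> 'rV[R]_n -> R) : set 'rV[R]_n :=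
  [set x | (forall i, 0 <= g i x) /\ (forall j, h j x = 0)].

(* The optimal value f_*; inf is meaningful only on a nonempty set which is
   bounded below. *)
Definition opt_value (R : realType) (n l m : nat) (f : 'rV[R]_n -> R)
    (g : 'I_l -> 'rV[R]_n -> R) (h : 'I_m -> 'rV[R]_n -> R) : R :=
  inf [set f x | x in feasible g h].

Definition minimizer (R : realType) (n l m : nat) (f : 'rV[R]_n -> R)
    (g : 'I_l -> 'rV[R]_n -> R) (h : 'I_m -> 'rV[R]_n -> R)
    (x : 'rV[R]_n) : Prop :=
  feasible g h x /\ f x = opt_value f g h.

Definition active (R : realType) (n l : nat) (g : 'I_l -> 'rV[R]_n -> R)
    (x : 'rV[R]_n) : {set 'I_l} :=
  [set i | g i x == 0]%SET.

Definition regular_at (R : realType) (n l m : nat)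
    (g : 'I_l -> 'rV[R]_n -> R) (h : 'I_m -> 'rV[R]_n -> R)
    (x : 'rV[R]_n) : Prop :=
  free ([seq gradient (g i) x | i in active g x] ++
        [seq gradient (h j) x | j : 'I_m]).

Definition KKT_multipliers (R : realType) (n l m : nat) (f : 'rV[R]_n -> R)
    (g : 'I_l -> 'rV[R]_n -> R) (h : 'I_m -> 'rV[R]_n -> R) (x : 'rV[R]_n)
    (lambda : 'I_l -> R) (nu : 'I_m -> R) : Prop :=
  gradient f x - \sum_i lambda i *: gradient (g i) x
               - \sum_j nu j *: gradient (h j) x = 0
  /\ forall i, lambda i * g i x = 0 /\ 0 <= lambda i.

(* At a regular minimizer the KKT multipliers exist and are unique; the two
   conditions below are about "the" multipliers, i.e. any family satisfying the
   KKT conditions, so that their existence is not made part of a hypothesis. *)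
Definition strict_complementarity (R : realType) (n l m : nat)
    (f : 'rV[R]_n -> R) (g : 'I_l -> 'rV[R]_n -> R) (h : 'I_m -> 'rV[R]_n -> R)
    (x : 'rV[R]_n) : Prop :=
  forall lambda nu, KKT_multipliers f g h x lambda nu ->
  forall i, 0 < lambda i + g i x.

Definition tangent_space (R : realType) (n l m : nat)
    (g : 'I_l -> 'rV[R]_n -> R) (h : 'I_m -> 'rV[R]_n -> R)
    (x : 'rV[R]_n) : set 'rV[R]_n :=
  [set v | (forall i, i \in active g x -> dot v (gradient (g i) x) = 0) /\
           (forall j, dot v (gradient (h j) x) = 0)].

Definition second_order_sufficiency (R : realType) (n l m : nat)
    (f : 'rV[R]_n -> R) (g : 'I_l -> 'rV[R]_n -> R) (h : 'I_m -> 'rV[R]_n -> R)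
    (x : 'rV[R]_n) : Prop :=
  forall lambda nu, KKT_multipliers f g h x lambda nu ->
  let L := fun y : 'rV[R]_n =>
    f y - \sum_(i in active g x) lambda i * g i y - \sum_j nu j * h j y in
  forall v, tangent_space g h x v -> v != 0 ->
    0 < (v *m hessian L x *m v^T) 0 0.

Definition sum_of_squares (R : realType) (D : o_minimal_structure R) (n k : nat)
    (phi : 'rV[R]_n -> R) : Prop :=
  exists (N : nat) (q : 'I_N -> 'rV[R]_n -> R),
    (forall r, definable_fun D (q r) /\ class_C k (q r)) /\
    (forall x, phi x = \sum_r q r x ^+ 2).

Definition representation (R : realType) (D : o_minimal_structure R)
    (n l m k : nat) (f : 'rV[R]_n -> R)
    (g : 'I_l -> 'rV[R]_n -> R) (h : 'I_m -> 'rV[R]_n -> R)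
    (phi0 : 'rV[R]_n -> R) (phi : 'I_l -> 'rV[R]_n -> R)
    (psi : 'I_m -> 'rV[R]_n -> R) : Prop :=
  [/\ [/\ definable_fun D phi0, class_C k phi0 & sum_of_squares D k phi0],
      forall i, [/\ definable_fun D (phi i), class_C k (phi i)
                  & sum_of_squares D k (phi i)],
      forall j, definable_fun D (psi j) /\ class_C k (psi j)
    & forall x, f x - opt_value f g h =
        phi0 x + \sum_i phi i x * g i x + \sum_j psi j x * h j x].

Definition gen_lagrangian (R : realType) (n l m : nat) (f : 'rV[R]_n -> R)
    (g : 'I_l -> 'rV[R]_n -> R) (h : 'I_m -> 'rV[R]_n -> R)
    (phi : 'I_l -> 'rV[R]_n -> R) (psi : 'I_m -> 'rV[R]_n -> R)
    (x : 'rV[R]_n) : R :=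
  f x - opt_value f g h - \sum_i phi i x * g i x - \sum_j psi j x * h j x.

(* Main.v *)
Require Import Defs.
From mathcomp Require Import all_boot all_order all_algebra.
From mathcomp Require Import all_classical all_reals all_analysis.
From mathcomp Require mpoly.
Import (canonicals) mpoly.
From mathcomp Require Import ring lra.

Import Order.TTheory GRing.Theory Num.Theory.
Import numFieldNormedType.Exports.
Local Open Scope classical_set_scope.
Local Open Scope ring_scope.

Set Implicit Arguments.
Unset Strict Implicit.
Unset Printing Implicit Defensive.

(** Write [F = f - f_*] and call a function [chi] certified if [chi * F] lies in
    the quadratic module generated by the [g i], [h j] and [- h j], with
    coefficients that are definable and of class [C^(p - 2)]; the first
    assertion says that the constant 1 is certified. Certified functions are
    closed under sums and under products with sums of squares, so that finitely
    many certified sums of squares without common zero suffice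
    ([certified_glue]): if [d] is their sum, then [1 = (d^-2 * d) * d]. Some of
    them are explicit: a high power of the positive part of [F], high powers of
    the negative parts of the [g i], and the squares of the [h j]. Their only
    common zeros are the minimizers of [f] on the feasible set, so that a
    certified function is needed near each minimizer, and there must be finitely
    many minimizers. Positive parts of functions thus play the role that cut-off
    functions and partitions of unity have in differential topology.

    Near a minimizer [a], Karush-Kuhn-Tucker multipliers exist ([KKT_exists], by
    penalization). The Lagrangian, shifted by [f_*], vanishes at [a] together
    with its gradient, and Hadamard's lemma, used twice, writes it as a
    quadratic form in [x - a] with coefficients of class [C^(p - 2)]; this is
    where two derivatives are lost. The coefficients stay definable because they
    are difference quotients. Adding a multiple of the squares of the active
    constraints makes the form positive definite at [a] ([finsler], by the
    second-order condition), and a Cholesky decomposition at [a] together with a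
    diagonal perturbation argument writes it near [a] as a sum of squares with
    positive weights. The price is that the multiplier of an active constraint
    becomes [lambda i - c * g i], which strict complementarity keeps positive
    near [a]. Multiplying by powers of the positive parts of the weights gives
    the certified function ([local_certificate]). The same identity shows that
    minimizers are isolated; being a closed definable set, they are finitely
    many ([definable_discrete_finite]).

    Conversely, at a minimizer all the terms of the representation are
    nonnegative and their sum is zero, so that each of them vanishes; the
    remaining assertions follow by differentiation, since a nonnegative function
    has zero gradient at its zeros. *)

(** * Definable sets and functions *)

Section Definability.
Variables (R : realType) (D : o_minimal_structure R).
Implicit Types (n m : nat).

Local Notation dset X := (definable D X).
Local Notation dfun u := (definable_fun D u).

Lemma dset_not n (P : 'rV[R]_n -> Prop) :
  dset [set x | P x] -> dset [set x | ~ P x].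
Proof. exact: definableC. Qed.

Lemma dset_or n (P Q : 'rV[R]_n -> Prop) :
  dset [set x | P x] -> dset [set x | Q x] -> dset [set x | P x \/ Q x].
Proof. exact: definableU. Qed.

Lemma dset_and n (P Q : 'rV[R]_n -> Prop) :
  dset [set x | P x] -> dset [set x | Q x] -> dset [set x | P x /\ Q x].
Proof.
move=> dP dQ.
rewrite (_ : mkset _ = [set x | ~ (~ P x \/ ~ Q x)]); last first.
  by apply/seteqP; split=> x /=; rewrite not_orE !notK.
by apply/dset_not/dset_or; exact: dset_not.
Qed.

Lemma dset_imp n (P Q : 'rV[R]_n -> Prop) :
  dset [set x | P x] -> dset [set x | Q x] -> dset [set x | P x -> Q x].
Proof.
move=> dP dQ.
rewrite (_ : mkset _ = [set x | ~ P x \/ Q x]); last first.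
  apply/seteqP; split=> x /=; last by move=> [].
  by have [Px /(_ Px)|] := pselect (P x); [right|left].
by apply: dset_or => //; exact: dset_not.
Qed.

Lemma dset_all n (I : finType) (P : I -> 'rV[R]_n -> Prop) :
  (forall i, dset [set x | P i x]) -> dset [set x | forall i, P i x].
Proof.
move=> dP.
have dPs (s : seq I) : dset [set x | forall i, i \in s -> P i x].
  elim: s => [|i s IHs].
    by rewrite (_ : mkset _ = setT); [exact: definableT | apply/seteqP; split].
  rewrite (_ : mkset _ = [set x | P i x /\ forall i, i \in s -> P i x]).
    exact: dset_and.
  apply/seteqP; split=> x /= Px.
    by split=> [|j js]; apply: Px; rewrite inE ?eqxx ?js ?orbT.
  by case: Px => Pi Ps j; rewrite inE => /orP[/eqP->|/Ps].
rewrite (_ : mkset _ = [set x | forall i, i \in enum I -> P i x]) //.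
apply/seteqP; split=> x /= Px i; first by move=> _; exact: Px.
by apply: Px; rewrite mem_enum.
Qed.

(** Equality of coordinates and the graphs of the ring operations are obtained
    in this way. *)
Lemma dset_zero_mpoly n (P : mpoly.mpoly n R) :
  dset [set x | mpoly.meval (fun i => x 0 i) P = 0].
Proof.
apply: definable_algebraic; exists 1%N, (fun=> P).
by apply/seteqP; split=> x /=; [move=> Px _ | apply; exact: ord0].
Qed.

Lemma dset_eq_coord n (i j : 'I_n) : dset [set x : 'rV[R]_n | x 0 i = x 0 j].
Proof.
rewrite (_ : mkset _ = [set x : 'rV[R]_n | mpoly.meval (fun i => x 0 i)
   (mpoly.mpolyX R (mpoly.mnm1 i) - mpoly.mpolyX R (mpoly.mnm1 j)) = 0]).
  exact: dset_zero_mpoly.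
apply/seteqP; split=> x /=; rewrite mpoly.mevalB !mpoly.mevalXU.
  by move=> ->; rewrite subrr.
by move/eqP; rewrite subr_eq0 => /eqP.
Qed.

(** Iterated projection. The dimension [N] is a variable, with a proof that [n
    <= N], since the induction would otherwise be obstructed by the
    associativity of the sum of the dimensions. *)
Lemma dset_widen_image n N (X : set 'rV[R]_N) (le_nN : (n <= N)%N) :
  dset X -> dset [set colsub (widen_ord le_nN) z | z in X].
Proof.
move: (subnK le_nN); rewrite addnC => /esym.
move: (N - n)%N => m; elim: m N X le_nN => [|m IHm] N X le_nN eN dX.
  rewrite addn0 in eN; case: _ / (esym eN) le_nN X dX => le_nn X dX.
  rewrite (_ : [set _ | _ in X] = X) //.
  have colsub_id z : colsub (widen_ord le_nn) z = z :> 'rV[R]_n.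
    by apply/rowP => i; rewrite mxE; congr (z _ _); exact: val_inj.
  apply/seteqP; split=> x /=; first by move=> [z Xz]; rewrite colsub_id => <-.
  by move=> Xx; exists x; rewrite ?colsub_id.
have {}eN : N = (n + m + 1)%N by rewrite eN addnS addn1.
case: _ / (esym eN) le_nN X dX => le_nN X dX.
have := IHm _ _ (leq_addr m n) erefl (definable_proj dX).
congr (definable D _); apply/seteqP; split=> x /=.
  move=> [_ [z Xz <-] <-]; exists z => //; apply/rowP => i; rewrite !mxE.
  by congr (z _ _); exact: val_inj.
move=> [z Xz <-]; exists (lsubmx z); first by exists z.
by apply/rowP => i; rewrite !mxE; congr (z _ _); exact: val_inj.
Qed.

Lemma lsubmx_colsub n m (z : 'rV[R]_(n + m)) : lsubmx z = colsub (lshift m) z.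
Proof. by apply/rowP => i; rewrite !mxE. Qed.

Lemma rsubmx_colsub n m (z : 'rV[R]_(n + m)) : rsubmx z = colsub (@rshift n _) z.
Proof. by apply/rowP => i; rewrite !mxE. Qed.

Lemma dset_lsubmx_image n m (X : set 'rV[R]_(n + m)) :
  dset X -> dset [set lsubmx z | z in X].
Proof.
move=> dX; have := dset_widen_image (leq_addr m n) dX; congr (definable D _).
apply/seteqP; split=> x /= [z Xz <-]; exists z => //; apply/rowP => i;
  by rewrite !mxE; congr (z _ _); exact: val_inj.
Qed.

Lemma dset_exists_vector n m (P : 'rV[R]_n -> 'rV[R]_m -> Prop) :
  dset [set z : 'rV[R]_(n + m) | P (lsubmx z) (rsubmx z)] ->
  dset [set x | exists w, P x w].
Proof.
move=> /dset_lsubmx_image; congr (definable D _); apply/seteqP; split=> x /=.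
  by move=> [z Pz <-]; exists (rsubmx z).
by move=> [w Pxw]; exists (row_mx x w); rewrite ?row_mxKl ?row_mxKr.
Qed.

Lemma dset_ex n (P : 'rV[R]_n -> R -> Prop) :
  dset [set z : 'rV[R]_(n + 1) | P (lsubmx z) (rsubmx z 0 0)] ->
  dset [set x | exists t, P x t].
Proof.
move=> /(@dset_exists_vector _ _ (fun x w => P x (w 0 0))); congr (definable D _).
apply/seteqP; split=> x /= [w Pw]; first by exists (w 0 0).
by exists (const_mx w); rewrite mxE.
Qed.

Lemma dset_forall n (P : 'rV[R]_n -> R -> Prop) :
  dset [set z : 'rV[R]_(n + 1) | P (lsubmx z) (rsubmx z 0 0)] ->
  dset [set x | forall t, P x t].
Proof.
move=> dP; rewrite (_ : mkset _ = [set x | ~ exists t, ~ P x t]); last first.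
  by apply/seteqP; split=> x /=; rewrite -forallNE => Px t; have := Px t;
    rewrite ?notK.
by apply/dset_not/dset_ex/dset_not.
Qed.

(** Substituting coordinates for variables, with repetitions allowed: the new
    variables are introduced by an existential quantifier and identified with
    the old ones by algebraic equations. *)
Lemma dset_colsub n m (s : 'I_m -> 'I_n) (X : set 'rV[R]_m) :
  dset X -> dset [set x : 'rV[R]_n | X (colsub s x)].
Proof.
move=> dX.
rewrite (_ : mkset _ =
  [set x : 'rV[R]_n | exists w : 'rV[R]_m,
     (forall k, x 0 (s k) = w 0 k) /\ X w]); last first.
  apply/seteqP; split=> x /=.
    by move=> Xx; exists (colsub s x); split=> // k; rewrite mxE.
  move=> [w [xw Xw]]; suff -> : colsub s x = w by [].
  by apply/rowP => k; rewrite mxE xw.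
apply: dset_exists_vector; apply: dset_and; last first.
  rewrite (_ : mkset _ = [set z | setT (lsubmx z) /\ X (rsubmx z)]).
    exact: definableX (definableT _ _) dX.
  by apply/seteqP; split=> z //= [].
apply: dset_all => k.
have := dset_eq_coord (lshift m (s k)) (rshift n k); congr (definable D _).
by apply/seteqP; split=> z /=; rewrite !mxE.
Qed.

Lemma split_lshift n m (i : 'I_n) : fintype.split (lshift m i) = inl i.
Proof. exact: (unsplitK (inl i)). Qed.

Lemma split_rshift n m (i : 'I_m) : fintype.split (rshift n i) = inr i.
Proof. exact: (unsplitK (inr i)). Qed.

Let split_shift := (split_lshift, split_rshift).

Lemma dset_graph n m (u : 'rV[R]_n -> R) (s : 'I_n -> 'I_m) (k : 'I_m) :
  dfun u -> dset [set z : 'rV[R]_m | z 0 k = u (colsub s z)].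
Proof.
move=> du.
have := dset_colsub (fun i : 'I_(n + 1) =>
  match fintype.split i with inl j => s j | inr _ => k end) du.
congr (definable D _); apply/seteqP; split=> z /=; rewrite !mxE !split_shift /=;
 rewrite (_ : lsubmx _ = colsub s z) //;
 by apply/rowP => i; rewrite !mxE split_shift.
Qed.

(** Substituting definable functions for variables, by the same method: this is
    what makes the definable functions closed under composition. *)
Lemma dset_subst m n (X : set 'rV[R]_m) (u : 'I_m -> 'rV[R]_n -> R) :
  dset X -> (forall k, dfun (u k)) -> dset [set x | X (\row_k u k x)].
Proof.
move=> dX du.
rewrite (_ : mkset _ =
  [set x : 'rV[R]_n | exists w : 'rV[R]_m,
     (forall k, w 0 k = u k x) /\ X w]); last first.
  apply/seteqP; split=> x /=.
    by move=> Xx; exists (\row_k u k x); split=> // k; rewrite mxE.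
  move=> [w [xw Xw]]; suff -> : \row_k u k x = w by [].
  by apply/rowP => k; rewrite mxE xw.
apply: dset_exists_vector; apply: dset_and; last first.
  have := dset_colsub (@rshift n _) dX; congr (definable D _).
  by apply/seteqP; split=> z /=; rewrite rsubmx_colsub.
apply: dset_all => k.
have := dset_graph (lshift m) (rshift n k) (du k); congr (definable D _).
by apply/seteqP; split=> z /=; rewrite lsubmx_colsub mxE.
Qed.

Lemma dfun_colsub n m (s : 'I_m -> 'I_n) (u : 'rV[R]_m -> R) :
  dfun u -> dfun (fun x => u (colsub s x)).
Proof.
move=> du; have := dset_graph (fun k => lshift 1 (s k)) (rshift n 0) du.
rewrite /definable_fun; congr (definable D _); apply/seteqP; split=> z /=; rewrite !mxE;
 rewrite (_ : colsub s (lsubmx z) = colsub (fun k => lshift 1 (s k)) z) //;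
 by apply/rowP => i; rewrite !mxE.
Qed.

Lemma dfun_lsubmx n m (u : 'rV[R]_n -> R) :
  dfun u -> dfun (fun z : 'rV[R]_(n + m) => u (lsubmx z)).
Proof.
move=> /(dfun_colsub (lshift m)); congr (definable_fun D _).
by apply/funext => z; rewrite lsubmx_colsub.
Qed.

Lemma dfun_coord n (i : 'I_n) : dfun (fun x => x 0 i).
Proof.
have := dset_eq_coord (rshift n (@ord0 0)) (lshift 1 i).
by rewrite /definable_fun; congr (definable D _); apply/seteqP; split=> z /=; rewrite !mxE.
Qed.

Lemma dfun_last n : dfun (fun z : 'rV[R]_(n + 1) => rsubmx z 0 0).
Proof.
have := dfun_coord (rshift n (@ord0 0)); congr (definable_fun D _).
by apply/funext => z; rewrite mxE.
Qed.

Lemma dfun_comp m n (f : 'rV[R]_m -> R) (u : 'I_m -> 'rV[R]_n -> R) :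
  dfun f -> (forall k, dfun (u k)) -> dfun (fun x => f (\row_k u k x)).
Proof.
move=> df du.
pose v (i : 'I_(m + 1)) (z : 'rV[R]_(n + 1)) :=
  match fintype.split i with inl j => u j (lsubmx z) | inr _ => rsubmx z 0 0 end.
have dv i : dfun (v i).
  by rewrite /v; case: (fintype.split i) => j; [exact: dfun_lsubmx (du j) |
    exact: dfun_last].
have := dset_subst df dv; congr (definable D _); apply/seteqP; split=> z /=;
 rewrite !mxE /v split_shift !mxE (_ : lsubmx (\row__ _) = \row_k u k (lsubmx z)) //;
 by apply/rowP => i; rewrite !mxE split_shift.
Qed.

Lemma dset_eq n (u v : 'rV[R]_n -> R) :
  dfun u -> dfun v -> dset [set x | u x = v x].
Proof.
move=> du dv.
have dw (k : 'I_2) : dfun (fun x => if k == 0 then u x else v x).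
  by case: (k == 0).
have := dset_subst (dset_eq_coord 0 1) dw; congr (definable D _).
by apply/seteqP; split=> z /=; rewrite !mxE.
Qed.

Lemma dfun_comp2 n (F : R -> R -> R) (u v : 'rV[R]_n -> R) :
  dfun (fun w : 'rV[R]_2 => F (w 0 0) (w 0 1)) -> dfun u -> dfun v ->
  dfun (fun x => F (u x) (v x)).
Proof.
move=> dF du dv.
have dw (k : 'I_2) : dfun (fun x => if k == 0 then u x else v x).
  by case: (k == 0).
have := dfun_comp dF dw.
by congr (definable_fun D _); apply/funext => z; rewrite !mxE.
Qed.

Lemma dfun_comp1 n (F : R -> R) (u : 'rV[R]_n -> R) :
  dfun (fun w : 'rV[R]_1 => F (w 0 0)) -> dfun u -> dfun (fun x => F (u x)).
Proof.
move=> dF du; have := dfun_comp dF (fun=> du).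
by congr (definable_fun D _); apply/funext => z; rewrite !mxE.
Qed.

Lemma dfun_mpoly n (P : mpoly.mpoly (n + 1) R) (u : 'rV[R]_n -> R) :
  (forall z : 'rV[R]_(n + 1), mpoly.meval (fun i => z 0 i) P =
     u (lsubmx z) - rsubmx z 0 0) -> dfun u.
Proof.
move=> Pu; have := dset_zero_mpoly P; rewrite /definable_fun; congr (definable D _).
apply/seteqP; split=> z /=; rewrite Pu; last by move=> ->; rewrite subrr.
by move/eqP; rewrite subr_eq0 => /eqP.
Qed.

Let X_ n (i : 'I_n) := mpoly.mpolyX R (mpoly.mnm1 i).

Lemma dfun_cst n (c : R) : dfun (fun _ : 'rV[R]_n => c).
Proof.
apply: (@dfun_mpoly _ (mpoly.mpolyC (n + 1) c - X_ (rshift n ord0))) => z.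
by rewrite mpoly.mevalB mpoly.mevalC mpoly.mevalXU !mxE.
Qed.

Lemma dfun_add n (u v : 'rV[R]_n -> R) :
  dfun u -> dfun v -> dfun (fun x => u x + v x).
Proof.
apply: (@dfun_comp2 _ +%R).
apply: (@dfun_mpoly _ (X_ (lshift 1 0) + X_ (lshift 1 1) - X_ (rshift 2 ord0))).
by move=> z; rewrite mpoly.mevalB mpoly.mevalD !mpoly.mevalXU !mxE.
Qed.

Lemma dfun_mul n (u v : 'rV[R]_n -> R) :
  dfun u -> dfun v -> dfun (fun x => u x * v x).
Proof.
apply: (@dfun_comp2 _ *%R).
apply: (@dfun_mpoly _ (X_ (lshift 1 0) * X_ (lshift 1 1) - X_ (rshift 2 ord0))).
by move=> z; rewrite mpoly.mevalB mpoly.mevalM !mpoly.mevalXU !mxE.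
Qed.

Lemma dfun_opp n (u : 'rV[R]_n -> R) : dfun u -> dfun (fun x => - u x).
Proof.
move=> /(dfun_mul (dfun_cst n (-1))); congr (definable_fun D _).
by apply/funext => z; rewrite mulN1r.
Qed.

Lemma dfun_sub n (u v : 'rV[R]_n -> R) :
  dfun u -> dfun v -> dfun (fun x => u x - v x).
Proof. by move=> du dv; apply: dfun_add => //; exact: dfun_opp. Qed.

Lemma dfun_exp n (u : 'rV[R]_n -> R) j : dfun u -> dfun (fun x => u x ^+ j).
Proof.
move=> du; elim: j => [|j IHj]; first exact: dfun_cst.
by under eq_fun do rewrite exprS; exact: dfun_mul.
Qed.

Lemma dfun_sum n (I : Type) (s : seq I) (P : pred I) (u : I -> 'rV[R]_n -> R) :
  (forall i, dfun (u i)) -> dfun (fun x => \sum_(i <- s | P i) u i x).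
Proof.
move=> du; elim: s => [|i s IHs].
  by under eq_fun do rewrite big_nil; exact: dfun_cst.
under eq_fun do rewrite big_cons.
by case: (P i) => //; exact: dfun_add.
Qed.

(** The order is definable from the ring structure: the nonnegative numbers are
    the squares. *)
Lemma dset_ge0 n (u : 'rV[R]_n -> R) : dfun u -> dset [set x | 0 <= u x].
Proof.
move=> du; rewrite (_ : mkset _ = [set x | exists t, u x = t * t]).
  apply: (@dset_ex _ (fun x t => u x = t * t)); apply: dset_eq.
    exact: dfun_lsubmx.
  by apply: dfun_mul; exact: dfun_last.
apply/seteqP; split=> x /=; last by move=> [t ->]; rewrite -expr2 sqr_ge0.
by move=> u0; exists (Num.sqrt (u x)); rewrite -expr2 sqr_sqrtr.
Qed.

Lemma dset_le n (u v : 'rV[R]_n -> R) :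
  dfun u -> dfun v -> dset [set x | u x <= v x].
Proof.
move=> du dv; have := dset_ge0 (dfun_sub dv du); congr (definable D _).
by apply/seteqP; split=> x /=; rewrite subr_ge0.
Qed.

Lemma dset_lt n (u v : 'rV[R]_n -> R) :
  dfun u -> dfun v -> dset [set x | u x < v x].
Proof.
move=> du dv; have := dset_not (dset_le dv du); congr (definable D _).
by apply/seteqP; split=> x /=; rewrite ltNge => /negP.
Qed.

Lemma dfun_inv n (u : 'rV[R]_n -> R) : dfun u -> dfun (fun x => (u x)^-1).
Proof.
apply: dfun_comp1; rewrite /definable_fun /=.
rewrite (_ : mkset _ = [set z : 'rV[R]_(1 + 1) |
   (lsubmx z 0 0) * rsubmx z 0 0 = 1 \/
   (lsubmx z 0 0 = 0 /\ rsubmx z 0 0 = 0)]).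
  have dl : dfun (fun z : 'rV[R]_(1 + 1) => lsubmx z 0 0).
    exact: (dfun_lsubmx 1 (dfun_coord (ord0 : 'I_1))).
  by apply: dset_or; [|apply: dset_and]; apply: dset_eq;
    try apply: dfun_mul; try exact: dfun_cst; try exact: dfun_last.
apply/seteqP; split=> z /=; set a := lsubmx z 0 0; set b := rsubmx z 0 0.
  move=> ->; have [->|a0] := eqVneq a 0; first by rewrite invr0; right.
  by left; rewrite mulfV.
move=> [ab|[-> ->]]; last by rewrite invr0.
have a0 : a != 0 by apply: contra_eq_neq ab => ->; rewrite mul0r eq_sym oner_neq0.
by apply: (mulfI a0); rewrite ab mulfV.
Qed.

Lemma dfun_sqrt n (u : 'rV[R]_n -> R) :
  dfun u -> dfun (fun x => Num.sqrt (u x)).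
Proof.
apply: dfun_comp1; rewrite /definable_fun /=.
rewrite (_ : mkset _ = [set z : 'rV[R]_(1 + 1) | 0 <= rsubmx z 0 0 /\
   (rsubmx z 0 0 * rsubmx z 0 0 = lsubmx z 0 0 \/
   (lsubmx z 0 0 <= 0 /\ rsubmx z 0 0 = 0))]).
  have dl : dfun (fun z : 'rV[R]_(1 + 1) => lsubmx z 0 0).
    exact: (dfun_lsubmx 1 (dfun_coord (ord0 : 'I_1))).
  have dr := @dfun_last 1; have d0 := @dfun_cst (1 + 1) 0.
  apply: dset_and; first exact: dset_ge0.
  apply: dset_or; first by apply: dset_eq => //; exact: dfun_mul.
  by apply: dset_and; [exact: dset_le | exact: dset_eq].
apply/seteqP; split=> z /=; set a := lsubmx z 0 0; set b := rsubmx z 0 0.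
  move=> ->; rewrite sqrtr_ge0; split=> //.
  have [a0|/ltW a0] := leP 0 a; first by left; rewrite -expr2 sqr_sqrtr.
  by right; rewrite ler0_sqrtr.
move=> [b0 [<-|[a0 ->]]]; last by rewrite ler0_sqrtr.
by rewrite -expr2 sqrtr_sqr ger0_norm.
Qed.

Lemma dfun_if n (P : 'rV[R]_n -> Prop) (b : 'rV[R]_n -> bool)
    (u v : 'rV[R]_n -> R) : (forall x, reflect (P x) (b x)) ->
  dset [set x | P x] -> dfun u -> dfun v ->
  dfun (fun x => if b x then u x else v x).
Proof.
move=> bP dP du dv; rewrite /definable_fun.
rewrite (_ : mkset _ = [set z : 'rV[R]_(n + 1) |
  (P (lsubmx z) /\ rsubmx z 0 0 = u (lsubmx z)) \/
  (~ P (lsubmx z) /\ rsubmx z 0 0 = v (lsubmx z))]).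
  have dPl : dset [set z : 'rV[R]_(n + 1) | P (lsubmx z)].
    have := dset_colsub (lshift 1) dP; congr (definable D _).
    by apply/seteqP; split=> z /=; rewrite lsubmx_colsub.
  by apply: dset_or; apply: dset_and => //; exact: dset_not.
apply/seteqP; split=> z /=.
  by case: bP => Pz ->; [left|right].
by case: bP => Pz [[? ->]|[? ->]].
Qed.

Lemma dset_coord_image n (X : set 'rV[R]_n) (i : 'I_n) :
  dset X -> dset [set (const_mx (x 0 i) : 'rV[R]_1) | x in X].
Proof.
move=> dX.
rewrite (_ : [set _ | _ in X] =
  [set y : 'rV[R]_1 | exists x : 'rV[R]_n, y 0 0 = x 0 i /\ X x]).
  apply: dset_exists_vector; apply: dset_and.
    have := dset_eq_coord (lshift n (@ord0 0)) (rshift 1 i); congr (definable D _).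
    by apply/seteqP; split=> z /=; rewrite !mxE.
  have := dset_colsub (@rshift 1 n) dX; congr (definable D _).
  by apply/seteqP; split=> z /=; rewrite rsubmx_colsub.
apply/seteqP; split=> y /=.
  by move=> [x Xx <-]; exists x; rewrite mxE.
move=> [x [yx Xx]]; exists x => //; apply/rowP => k.
by rewrite mxE (ord1 k).
Qed.

End Definability.

(** * Functions of class C^k *)

Section ClassC.
Variables (R : realType) (n : nat).
Implicit Types (f g u v w : 'rV[R]_n -> R) (x : 'rV[R]_n) (k j : nat).

Lemma is_derive_line f x (v : 'rV[R]_n) (t d : R) :
  is_derive (t *: v + x) v f d <-> is_derive t 1 (fun s : R => f (s *: v + x)) d.
Proof.
suff E : (fun h : R => h^-1 *: ((f \o shift (t *: v + x)) (h *: v) - f (t *: v + x)))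
    = (fun h : R => h^-1 *: (((fun s : R => f (s *: v + x)) \o shift t) (h *: 1)
          - f (t *: v + x))).
  by split=> -[H1 H2]; split; move: H1 H2; rewrite /derivable /derive E.
by apply/funext => h /=; rewrite addrA -scalerDl [h *: 1]mulr1.
Qed.

Lemma is_derive_line0 f x (v : 'rV[R]_n) d :
  is_derive x v f d <-> is_derive (0 : R) 1 (fun s : R => f (s *: v + x)) d.
Proof. by rewrite -is_derive_line scale0r add0r. Qed.

Lemma is_derive_compR (F : R -> R) w x (v : 'rV[R]_n) (dF dw : R) :
  is_derive (w x) 1 F dF -> is_derive x v w dw ->
  is_derive x v (fun y => F (w y)) (dF * dw).
Proof.
move=> HF /is_derive_line0 Hw; apply/is_derive_line0.
by apply: (@is_derive1_comp _ F); rewrite scale0r add0r.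
Qed.

Lemma class_C_continuous k f : class_C k f -> continuous f.
Proof. by case: k => [|k] []. Qed.

Lemma class_C_is_derive k f i x : class_C k.+1 f ->
  is_derive x (delta_mx 0 i) f (partial i f x).
Proof. by move=> [_ /(_ i)[df _]]; exact: derivableP. Qed.

Lemma class_C_partial k f i : class_C k.+1 f -> class_C k (partial i f).
Proof. by move=> [_ /(_ i)[]]. Qed.

Lemma partialE f i (d : 'rV[R]_n -> R) :
  (forall x, is_derive x (delta_mx 0 i) f (d x)) -> partial i f = d.
Proof. by move=> df; apply/funext => x; exact: derive_val. Qed.

(** A function is shown to be of class [C^(k + 1)] by exhibiting its partial
    derivatives, which avoids computing with the total operator ['D]. *)
Lemma class_CS k f : continuous f -> (forall i, exists d : 'rV[R]_n -> R,
  (forall x, is_derive x (delta_mx 0 i) f (d x)) /\ class_C k d) ->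
  class_C k.+1 f.
Proof.
move=> cf df; split=> // i; have [d [fd dC]] := df i.
by rewrite (partialE fd); split=> // x; exact: ex_derive.
Qed.

Lemma class_C_pred k f : class_C k.+1 f -> class_C k f.
Proof.
elim: k f => [|k IHk] f; first by case.
move=> fC; apply: class_CS; first exact: class_C_continuous fC.
move=> i; exists (partial i f); split=> [x|]; first exact: class_C_is_derive fC.
by apply: IHk; exact: class_C_partial.
Qed.

Lemma class_C_leq k j f : (j <= k)%N -> class_C k f -> class_C j f.
Proof.
move=> /subnK <-; elim: (k - j)%N => // d IHd; rewrite addSn => /class_C_pred.
exact: IHd.
Qed.

Lemma class_C_cst k (c : R) : class_C k (fun _ : 'rV[R]_n => c).
Proof.
elim: k c => [|k IHk] c; first by split=> //; exact: cst_continuous.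
apply: class_CS => [|i]; first exact: cst_continuous.
exists (fun=> 0); split=> // x; exact: is_derive_cst.
Qed.

Lemma is_derive_coord (i j : 'I_n) x :
  is_derive x (delta_mx 0 i) (fun y : 'rV[R]_n => y 0 j) ((i == j)%:R).
Proof.
apply/is_derive_line0.
rewrite (_ : (fun s : R => _) = (fun s : R => (i == j)%:R * s + x 0 j)).
  have H : is_derive (0 : R) 1 (fun s : R => (i == j)%:R * s + x 0 j)
     ((i == j)%:R *: (1 : R) + 0).
    exact: is_deriveD.
  by apply: is_derive_eq H _; rewrite addr0 [_ *: 1]mulr1.
by apply/funext => s; rewrite !mxE eqxx /= eq_sym mulrC.
Qed.

Lemma class_C_coord k (j : 'I_n) : class_C k (fun x : 'rV[R]_n => x 0 j).
Proof.
case: k => [|k]; first by split=> //; exact: coord_continuous.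
apply: class_CS => [|i]; first exact: coord_continuous.
exists (fun=> (i == j)%:R); split=> [x|]; first exact: is_derive_coord.
exact: class_C_cst.
Qed.

Lemma class_C_add k f g : class_C k f -> class_C k g ->
  class_C k (fun x => f x + g x).
Proof.
elim: k f g => [|k IHk] f g fC gC.
  split=> // x.
  exact: (cvgD (class_C_continuous fC (x:=x)) (class_C_continuous gC (x:=x))).
apply: class_CS => [x|i].
  exact: (cvgD (class_C_continuous fC (x:=x)) (class_C_continuous gC (x:=x))).
exists (fun x => partial i f x + partial i g x); split=> [x|].
  exact: (is_deriveD (class_C_is_derive i x fC) (class_C_is_derive i x gC)).
by apply: IHk; exact: class_C_partial.
Qed.

Lemma class_C_mul k f g : class_C k f -> class_C k g ->
  class_C k (fun x => f x * g x).
Proof.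
elim: k f g => [|k IHk] f g fC gC.
  split=> // x.
  exact: (cvgM (class_C_continuous fC (x:=x)) (class_C_continuous gC (x:=x))).
apply: class_CS => [x|i].
  exact: (cvgM (class_C_continuous fC (x:=x)) (class_C_continuous gC (x:=x))).
exists (fun x => f x * partial i g x + g x * partial i f x); split=> [x|].
  exact: (is_deriveM (class_C_is_derive i x fC) (class_C_is_derive i x gC)).
by apply: class_C_add; apply: IHk;
  (exact: class_C_partial || exact: class_C_pred).
Qed.

Lemma class_C_opp k f : class_C k f -> class_C k (fun x => - f x).
Proof.
move=> /(class_C_mul (class_C_cst k (-1))); congr class_C.
by apply/funext => x; rewrite mulN1r.
Qed.

Lemma class_C_sub k f g : class_C k f -> class_C k g ->
  class_C k (fun x => f x - g x).
Proof. by move=> fC gC; apply: class_C_add => //; exact: class_C_opp. Qed.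

Lemma class_C_exp k f j : class_C k f -> class_C k (fun x => f x ^+ j).
Proof.
move=> fC; elim: j => [|j IHj]; first exact: class_C_cst.
by under eq_fun do rewrite exprS; exact: class_C_mul.
Qed.

Lemma class_C_sum k (I : Type) (s : seq I) (P : pred I) (f : I -> 'rV[R]_n -> R) :
  (forall i, class_C k (f i)) -> class_C k (fun x => \sum_(i <- s | P i) f i x).
Proof.
move=> fC; elim: s => [|i s IHs].
  by under eq_fun do rewrite big_nil; exact: class_C_cst.
under eq_fun do rewrite big_cons.
by case: (P i) => //; exact: class_C_add.
Qed.

Lemma class_C_inv k f : (forall x, f x != 0) -> class_C k f ->
  class_C k (fun x => (f x)^-1).
Proof.
move=> f0; elim: k => [|k IHk] fC.
  by split=> // x; exact: (cvgV (f0 x) (class_C_continuous fC (x:=x))).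
apply: class_CS => [x|i].
  exact: (cvgV (f0 x) (class_C_continuous fC (x:=x))).
exists (fun x => - ((f x)^-1 * (f x)^-1) * partial i f x); split=> [x|].
  have df : derivable f x (delta_mx 0 i) by case: fC => _ /(_ i) [].
  apply: DeriveDef; first exact: derivableV.
  by rewrite (deriveV (f0 x) df) expr2 invfM.
have fC' := IHk (class_C_pred fC).
apply: class_C_mul; last exact: class_C_partial.
by apply: class_C_opp; exact: class_C_mul.
Qed.

(** Half-integer powers of the positive part: [Num.sqrt] vanishes on negative
    numbers. Half-integers are needed because two consecutive powers of the
    positive part both have to be squares of functions of class [C^k]. *)
Definition sqrtpow j (t : R) : R := Num.sqrt t ^+ j.

Lemma sqrtpow_ge0 j t : 0 <= sqrtpow j t.
Proof. by rewrite exprn_ge0 // sqrtr_ge0. Qed.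

Lemma sqrtpow_gt0 j t : (0 < j)%N -> (0 < sqrtpow j t) = (0 < t).
Proof.
move=> j0; rewrite /sqrtpow; have [t0|t0] := ltP 0 t.
  by rewrite exprn_gt0 // sqrtr_gt0.
by rewrite ler0_sqrtr // expr0n gtn_eqF // ltxx.
Qed.

Lemma sqrtpow_mul j t : (0 < j)%N -> t * sqrtpow j t = sqrtpow j.+2 t.
Proof.
move=> j0; rewrite /sqrtpow; have [t0|t0] := leP 0 t.
  by rewrite -[X in X * _](sqr_sqrtr t0) -exprD.
by rewrite ler0_sqrtr ?ltW // !expr0n gtn_eqF // mulr0.
Qed.

Lemma sqrtpow_continuous j : continuous (sqrtpow j).
Proof.
move=> t; apply: (@cvg_comp _ _ _ Num.sqrt (fun s => s ^+ j)).
  exact: sqrt_continuous.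
exact: exprn_continuous.
Qed.

Lemma is_derive_sqrtpow j (t : R) :
  is_derive t (1 : R) (sqrtpow j.+3) (j.+3%:R / 2 * sqrtpow j.+1 t).
Proof.
have [t0|t0|t0] := ltgtP t 0.
- apply: (@near_eq_is_derive _ _ _ (cst 0)).
  + near=> s; rewrite /cst /sqrtpow ler0_sqrtr ?expr0n //; apply: ltW.
    by near: s; exact: lt_nbhsl.
  + rewrite /sqrtpow ler0_sqrtr ?ltW // expr0n mulr0; exact: is_derive_cst.
- have := is_derive1_sqrt t0 => /(is_deriveX j.+3).
  rewrite exprfctE => H; apply: (is_derive_eq H).
  rewrite /sqrtpow -pred_Sn (exprSr _ j.+1).
  have s0 : Num.sqrt t != 0 by rewrite gt_eqF // sqrtr_gt0.
  by rewrite /GRing.scale /=; set e := _ ^+ _; set c := _%:R; field.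
- rewrite t0 {t0} (_ : _ * _ = 0); last first.
    by rewrite /sqrtpow sqrtr0 expr0n mulr0.
  suff H : (fun h : R => h^-1 *: ((sqrtpow j.+3 \o shift 0) (h *: (1 : R)) -
     sqrtpow j.+3 0)) @ 0^' --> (0 : R).
    by apply: DeriveDef; [apply/cvg_ex; exists 0 | exact: cvg_lim H].
  apply: (@cvg_trans _ (sqrtpow j.+1 @ 0^')).
    apply: near_eq_cvg; near=> h.
    have h0 : h != 0 by near: h; exact: nbhs_dnbhs_neq.
    rewrite /= addr0 [h *: 1]mulr1 -sqrtpow_mul //.
    by rewrite [sqrtpow _ 0]/sqrtpow sqrtr0 expr0n subr0 [_ *: _]mulKf.
  apply: cvg_within_filter.
  have := @sqrtpow_continuous j.+1 0.
  by rewrite /continuous_at {2}/sqrtpow sqrtr0 expr0n.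
Unshelve. all: by end_near. Qed.

(** Each derivative costs one unit of the exponent [j / 2] and continuity
    requires [0 < j]. *)
Lemma class_C_sqrtpow k j w : (k.*2 < j)%N -> class_C k w ->
  class_C k (fun x => sqrtpow j (w x)).
Proof.
elim: k j w => [|k IHk] j w kj wC.
  split=> // x.
  exact: (continuous_comp (class_C_continuous wC (x:=x)) (@sqrtpow_continuous _ _)).
case: j kj => [|[|[|j]]] // kj.
apply: class_CS => [x|i].
  exact: (continuous_comp (class_C_continuous wC (x:=x)) (@sqrtpow_continuous _ _)).
exists (fun x => j.+3%:R / 2 * sqrtpow j.+1 (w x) * partial i w x); split.
  move=> x; apply: is_derive_compR; first exact: is_derive_sqrtpow.
  exact: class_C_is_derive wC.
apply: class_C_mul; last exact: class_C_partial.
apply: class_C_mul; first exact: class_C_cst.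
by apply: IHk => //; exact: class_C_pred.
Qed.

Lemma partial_at_min f i x (d : R) : is_derive x (delta_mx 0 i) f d ->
  (forall y, derivable f y (delta_mx 0 i)) ->
  (\forall y \near x, f x <= f y) -> d = 0.
Proof.
move=> fd df xmin.
have : \forall s \near (0 : R), f x <= f (s *: delta_mx 0 i + x).
  have H : (fun s : R => s *: delta_mx 0 i + x) @ (0 : R) -->
      ((0 : R) *: delta_mx 0 i + x : 'rV[R]_n).
    have c0 : (fun s : R => s) @ (0 : R) --> (0 : R) by exact: cvg_id.
    exact: (cvgD (cvgZr_tmp (a := delta_mx 0 i : 'rV[R]_n) c0) (cvg_cst x)).
  by rewrite scale0r add0r in H; exact: (H _ xmin).
move=> [e /= e0 He].
have min0 : is_derive (0 : R) 1 (fun s : R => f (s *: delta_mx 0 i + x)) 0;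
  last first.
  move/is_derive_line0 : fd => fd.
  by rewrite -(@derive_val _ _ _ _ _ _ _ fd) (@derive_val _ _ _ _ _ _ _ min0).
apply: (@derive1_at_min _ _ (- e) e); first by rewrite ge0_cp // ltW.
- move=> t _; have /derivableP/is_derive_line := df (t *: delta_mx 0 i + x).
  by move=> H; exact: ex_derive.
- by rewrite in_itv /= oppr_lt0 e0.
- move=> t; rewrite in_itv /= => te; rewrite scale0r add0r; apply: He.
  by rewrite /= sub0r normrN ltr_norml.
Qed.

End ClassC.

(** * Definability of the partial derivatives *)

Section DefinablePartial.
Variables (R : realType) (D : o_minimal_structure R) (n : nat).

(** The right-hand side is a first-order formula in [f], the ring operations and
    the order, with squares in place of absolute values: this is what makes the
    partial derivatives of a definable function definable. *)
Lemma derive_squareP (f : 'rV[R]_n -> R) (x v : 'rV[R]_n) (y : R) :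
  derivable f x v ->
  'D_v f x = y <-> forall e, 0 < e -> exists d, 0 < d /\
    forall t, t * t < d -> (f (x + t *: v) - f x - t * y) ^+ 2 <= e * (t * t).
Proof.
move=> df; split=> [<- {y} e e0|Hy].
  have H := df : _ @ _ --> 'D_v f x.
  have se0 : 0 < Num.sqrt e by rewrite sqrtr_gt0.
  move/cvgrPdist_le : H => /(_ _ se0) [d /= d0 Hd].
  exists (d ^+ 2); split=> [|t td]; first by rewrite exprn_gt0.
  have [->|t0] := eqVneq t 0; first by rewrite scale0r addr0 subrr !mul0r subr0 expr0n mulr0.
  have {}td : `|t| < d by rewrite -(ltr_pXn2r (_ : 0 < 2)%N) ?nnegrE // ?ltW //
    real_normK ?num_real // expr2.
  have {Hd} := Hd t; rewrite /= sub0r normrN => /(_ td t0).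
  set q := _ *: _ => Hq.
  have -> : f (x + t *: v) - f x - t * 'D_v f x = t * (q - 'D_v f x).
    by rewrite mulrBr [t * q]mulVKf // addrC [in LHS]addrC [x + _]addrC.
  rewrite exprMn mulrC -expr2 ler_wpM2r ?sqr_ge0 //.
  rewrite -(sqr_sqrtr (ltW e0)) -[leLHS]real_normK ?num_real // lerXn2r ?nnegrE //.
  by rewrite distrC.
apply: cvg_lim => //; apply/cvgrPdist_le => e e0.
have [d [d0 Hd]] := Hy (e ^+ 2) (exprn_gt0 _ e0).
exists (Num.sqrt d) => /=; first by rewrite sqrtr_gt0.
move=> t /=; rewrite sub0r normrN => td t0.
have {}td : t * t < d.
  rewrite -(sqr_sqrtr (ltW d0)) -expr2 -[t ^+ 2]real_normK ?num_real //.
  by rewrite ltrXn2r // ?nnegrE // sqrtr_ge0.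
have {Hd} := Hd t td; rewrite [x + _]addrC; set q := _ - f x => Hq.
rewrite -(ler_pXn2r (_ : 0 < 2)%N) ?nnegrE ?(ltW e0) // real_normK ?num_real //.
have tt0 : 0 < t * t by rewrite -expr2 exprn_even_gt0.
rewrite -(ler_pM2r tt0); apply: le_trans Hq; rewrite -expr2 -exprMn.
rewrite -sqrrN le_eqVlt; apply/orP; left; apply/eqP; congr (_ ^+ 2).
by rewrite /GRing.scale /=; field.
Qed.

Lemma dfun_partial (f : 'rV[R]_n -> R) (i : 'I_n) :
  definable_fun D f -> (forall x, derivable f x (delta_mx 0 i)) ->
  definable_fun D (partial i f).
Proof.
move=> fD df; rewrite /definable_fun.
rewrite (_ : mkset _ = [set z : 'rV[R]_(n + 1) |
  forall e, 0 < e -> exists d, 0 < d /\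
    forall t, t * t < d -> (f (\row_k (lsubmx z 0 k + t * (k == i)%:R)) -
      f (lsubmx z) - t * rsubmx z 0 0) ^+ 2 <= e * (t * t)]); last first.
  have row_line (x : 'rV[R]_n) (t : R) :
      \row_k (x 0 k + t * (k == i)%:R) = x + t *: delta_mx 0 i.
    by apply/rowP => k; rewrite !mxE eqxx.
  apply/seteqP; split=> z /=.
    move=> /esym/(derive_squareP _ (df _)) H e /H [d [d0 Hd]]; exists d; split=> //.
    by move=> t; rewrite row_line; exact: Hd.
  move=> H; apply/esym/(derive_squareP _ (df _)) => e /H [d [d0 Hd]].
  by exists d; split=> // t; rewrite -row_line; exact: Hd.
apply: dset_forall; apply: dset_imp.
  by apply: dset_lt; [exact: dfun_cst | exact: dfun_last].
apply: dset_ex; apply: dset_and.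
  by apply: dset_lt; [exact: dfun_cst | exact: dfun_last].
have dl m u : definable_fun D u -> definable_fun D (fun z => u (lsubmx z)) :=
  @dfun_lsubmx _ _ m 1 u.
have dt m := @dfun_last _ D m.
apply: dset_forall; apply: dset_imp.
  by apply: dset_lt; [exact: (dfun_mul (dt _) (dt _)) | exact: (dl _ _ (dt _))].
apply: dset_le; last first.
  exact: (dfun_mul (dl _ _ (dl _ _ (dt _))) (dfun_mul (dt _) (dt _))).
apply: dfun_exp; apply: dfun_sub; last first.
  exact: (dfun_mul (dt _) (dl _ _ (dl _ _ (dl _ _ (dt _))))).
apply: dfun_sub; last exact: (dl _ _ (dl _ _ (dl _ _ (dl _ _ fD)))).
apply: dfun_comp => // k; apply: dfun_add.
  exact: (dl _ _ (dl _ _ (dl _ _ (dl _ _ (dfun_coord D k))))).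
exact: (dfun_mul (dt _) (dfun_cst _ _ _)).
Qed.

End DefinablePartial.

(** * Hadamard's lemma *)

Section UnitInterval.
Variable R : realType.

Definition integral01 (p : R -> R) : R :=
  (\int[@lebesgue_measure R]_(t in `[0, 1]%classic) p t)%R.

Lemma integrable01 (p : R -> R) : continuous p ->
  (@lebesgue_measure R).-integrable `[0, 1]%classic (EFin \o p).
Proof.
move=> cp; apply: continuous_compact_integrable; first exact: segment_compact.
exact: continuous_subspaceT.
Qed.

Lemma integral01_sub (p q : R -> R) : continuous p -> continuous q ->
  integral01 (fun t => p t - q t) = integral01 p - integral01 q.
Proof. by move=> cp cq; rewrite /integral01 RintegralB//; exact: integrable01. Qed.

Lemma integral01_scale (c : R) (p : R -> R) : continuous p ->
  integral01 (fun t => c * p t) = c * integral01 p.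
Proof. by move=> cp; rewrite /integral01 RintegralZl//; exact: integrable01. Qed.

Lemma integral01_cst (c : R) : integral01 (fun=> c) = c.
Proof.
by rewrite /integral01 Rintegral_cst //= lebesgue_measure_itv/= lte_fin ltr01
  sube0 /= mulr1.
Qed.

Lemma integral01_normr_le (p : R -> R) (e : R) : continuous p ->
  (forall t, 0 <= t <= 1 -> `|p t| <= e) -> `|integral01 p| <= e.
Proof.
move=> cp pe; have ip := integrable01 cp.
apply: le_trans (le_normr_Rintegral _ ip) _ => //.
rewrite -[leRHS](integral01_cst e); apply: le_Rintegral => //.
- apply: integrable01 => t; apply: cvg_norm; exact: cp.
- by apply: integrable01 => t; exact: cvg_cst.
Qed.

Lemma integral01_derive (P p : R -> R) : continuous p ->
  (forall t : R, is_derive t (1 : R) P (p t)) -> integral01 p = P 1 - P 0.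
Proof.
move=> cp dP.
have cP : continuous P.
  by move=> t; apply/differentiable_continuous/derivable1_diffP; exact: ex_derive.
rewrite /integral01 /Rintegral (@continuous_FTC2 _ p P) //.
- exact: continuous_subspaceT.
- split; first by move=> t _; exact: ex_derive.
    by apply: cvg_at_right_filter; exact: cP.
  by apply: cvg_at_left_filter; exact: cP.
- by move=> t _; rewrite derive1E; exact: derive_val.
Qed.

Lemma mean_value (P p : R -> R) (h : R) : (forall t : R, is_derive t (1 : R) P (p t)) ->
  exists2 s, `|s| <= `|h| & P h - P 0 = h * p s.
Proof.
move=> dP.
have cP : continuous P.
  by move=> t; apply/differentiable_continuous/derivable1_diffP; exact: ex_derive.
have cPw a b : {within `[a, b], continuous P} by exact: continuous_subspaceT.
have [h0|/ltW h0] := leP 0 h.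
  have [s] := MVT_segment h0 (fun t _ => dP t) (cPw _ _).
  rewrite in_itv /= => /andP[s0 sh] Ps; exists s.
    by rewrite !ger0_norm.
  by rewrite Ps subr0 mulrC.
have [s] := MVT_segment h0 (fun t _ => dP t) (cPw _ _).
rewrite in_itv /= => /andP[s0 sh] Ps; exists s.
  by rewrite !ler0_norm // lerN2.
by apply/eqP; rewrite -eqr_opp opprB Ps sub0r mulrN mulrC.
Qed.

End UnitInterval.

Section Hadamard.
Variables (R : realType) (n : nat).
Implicit Types (u v f : 'rV[R]_n -> R) (x y a : 'rV[R]_n) (k m : nat) (i j : 'I_n).

Definition diag_affine (al be : 'I_n -> R) x : 'rV[R]_n :=
  \row_j (al j * x 0 j + be j).

Lemma diag_affine_line al be x j (s : R) :
  diag_affine al be (s *: delta_mx 0 j + x) =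
  (al j * s) *: delta_mx 0 j + diag_affine al be x.
Proof.
apply/rowP => l; rewrite !mxE !eqxx /=; case: eqP => [->|_] /=; ring.
Qed.

Lemma is_derive_diag_affine f al be x j (d : R) :
  is_derive (diag_affine al be x) (delta_mx 0 j) f d ->
  is_derive x (delta_mx 0 j) (fun y => f (diag_affine al be y)) (al j * d).
Proof.
move=> /is_derive_line0 fd; apply/is_derive_line0.
under eq_fun do rewrite diag_affine_line.
rewrite mulrC.
apply: (@is_derive1_comp _ (fun s => f (s *: delta_mx 0 j + diag_affine al be x))
  (fun s => al j * s)); first by rewrite mulr0.
have H : is_derive (0 : R) (1 : R) (fun s : R => al j * s) (al j *: 1).
  exact: (@is_deriveZ _ _ _ id).
by rewrite [_ *: 1]mulr1 in H.
Qed.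

Lemma cvg_row (T : Type) (F : set_system T) {FF : Filter F}
    (h : T -> 'rV[R]_n) (y : 'rV[R]_n) :
  (forall j, (fun t => h t 0 j) @ F --> y 0 j) -> h @ F --> y.
Proof.
move=> hy; apply/cvgrPdist_le => e e0.
have H : \forall t \near F, forall j, `|y 0 j - h t 0 j| <= e.
  apply: filter_forall => j.
  by have /cvgrPdist_le := hy j; apply.
apply: filterS H => t Ht; rewrite [leLHS]mx_normrE.
apply/bigmax_leP; split; first exact: ltW.
by move=> [l j] _ /=; rewrite !mxE (ord1 l).
Qed.

Lemma diag_affine_continuous al be : continuous (diag_affine al be).
Proof.
move=> x; apply: (@cvg_row _ (nbhs x)) => j; rewrite [X in _ --> X]mxE.
under eq_fun do rewrite mxE.
apply: (@cvgD _ _ _ _ _ (fun y : 'rV[R]_n => al j * y 0 j) (fun=> be j));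
  last exact: cvg_cst.
have cx : (fun y : 'rV[R]_n => y 0 j) @ x --> x 0 j by exact: coord_continuous.
exact: (cvgMl_tmp cx).
Qed.

Lemma class_C_diag_affine k f al be : class_C k f ->
  class_C k (fun x => f (diag_affine al be x)).
Proof.
elim: k f => [|k IHk] f fC.
  split=> // x.
  exact: (continuous_comp (@diag_affine_continuous al be x)
    (class_C_continuous fC (x := diag_affine al be x))).
apply: class_CS => [x|j].
  exact: (continuous_comp (@diag_affine_continuous al be x)
    (class_C_continuous fC (x := diag_affine al be x))).
exists (fun x => al j * partial j f (diag_affine al be x)); split=> [x|].
  by apply: is_derive_diag_affine; exact: class_C_is_derive fC.
apply: class_C_mul; first exact: class_C_cst.
by apply: IHk; exact: class_C_partial.
Qed.

(** A homothety of the coordinate number [i] centred at that of [a], written as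
    a diagonal affine map so that [is_derive_diag_affine] applies. *)
Definition contract i a (t : R) : 'rV[R]_n -> 'rV[R]_n :=
  diag_affine (fun j => if j == i then t else 1)
              (fun j => if j == i then (1 - t) * a 0 i else 0).

Lemma contractE i a t x j :
  contract i a t x 0 j = if j == i then a 0 i + t * (x 0 i - a 0 i) else x 0 j.
Proof. by rewrite mxE; case: eqP => [->|_] /=; ring. Qed.

Lemma contract1 i a x : contract i a 1 x = x.
Proof. by apply/rowP => j; rewrite contractE; case: eqP => // -> /=; ring. Qed.

Lemma contract_line i a t x :
  contract i a t x = t *: ((x 0 i - a 0 i) *: delta_mx 0 i) + contract i a 0 x.
Proof.
by apply/rowP => j; rewrite [in RHS]mxE !contractE !mxE eqxx /=; case: eqP => _ /=; ring.
Qed.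

Lemma contract_continuous2 i a (t : R) x :
  (fun z : R * 'rV[R]_n => contract i a z.1 z.2) @ (t, x) --> contract i a t x.
Proof.
apply: (@cvg_row _ (nbhs (t, x))) => j; rewrite contractE; under eq_fun do rewrite contractE.
have cc (l : 'I_n) : (fun z : R * 'rV[R]_n => z.2 0 l) @ (t, x) --> x 0 l.
  apply: (@cvg_comp _ _ _ snd (fun y : 'rV[R]_n => y 0 l) _ (nbhs x)).
    exact: cvg_snd.
  exact: coord_continuous.
have ct : (fun z : R * 'rV[R]_n => z.1) @ (t, x) --> t by exact: cvg_fst.
case: (j == i); last exact: cc.
exact: (cvgD (cvg_cst (a 0 i)) (cvgM ct (cvgB (cc i) (cvg_cst (a 0 i))))).
Qed.

(** Compactness of the segment turns joint continuity into uniformity in [t]. *)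
Lemma contract_uniform f i a x (e : R) : continuous f -> 0 < e ->
  \forall y \near x, forall t : R, 0 <= t <= 1 ->
    `|f (contract i a t y) - f (contract i a t x)| <= e.
Proof.
move=> cf e0.
have e20 : 0 < e / 2 by rewrite divr_gt0.
have cft (t : R) : (fun z : R * 'rV[R]_n => f (contract i a z.1 z.2)) @ (t, x) -->
    f (contract i a t x).
  apply: (@cvg_comp _ _ _ (fun z : R * 'rV[R]_n => contract i a z.1 z.2) f);
    last exact: (cf (contract i a t x)).
  exact: contract_continuous2.
have /compact_near_coveringP/(_ _ _ (fun y (t : R) =>
  `|f (contract i a t y) - f (contract i a t x)| <= e) (nbhs_filter x)) :=
  @segment_compact R 0 1.
have H (t : R) : `[0, 1]%classic t -> \forall t' \near t & y \near x,
    `|f (contract i a t' y) - f (contract i a t' x)| <= e.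
  move=> _.
  have /cvgrPdist_le /(_ _ e20) [[A B] [/= tA xB] HAB] := cft t.
  exists (A, B) => //= -[t' y] [/= At By].
  have H1 := HAB (t', y) (conj At By).
  have H2 := HAB (t', x) (conj At (nbhs_singleton xB)).
  rewrite distrC in H1.
  rewrite (splitr e) -[X in `|X|](subrKA (f (contract i a t x))).
  exact: le_trans (ler_normD _ _) (lerD H1 H2).
move=> /(_ H); apply: filterS => y Hy t t01; apply: Hy.
by rewrite /= in_itv.
Qed.

Lemma contract_path_continuous f i a x : continuous f ->
  continuous (fun t : R => f (contract i a t x)).
Proof.
move=> cf t; apply: (@cvg_comp _ _ _ (fun t => contract i a t x) f); last exact: cf.
apply: (@cvg_comp _ _ _ (fun s : R => (s, x)) (fun z => contract i a z.1 z.2));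
  last exact: contract_continuous2.
have ct : (fun s : R => s) @ t --> t by exact: cvg_id.
exact: (cvg_pair ct (cvg_cst x)).
Qed.

Lemma norm_delta_le1 j : `|delta_mx 0 j : 'rV[R]_n| <= 1.
Proof.
rewrite [leLHS]mx_normrE; apply/bigmax_leP; split=> // -[l k] _ /=.
by rewrite mxE; case: (_ && _); rewrite ?normr1 ?normr0.
Qed.

(** All the orders [m] are considered at once because differentiation raises the
    order; [moment 0] is what occurs in Hadamard's lemma. *)
Definition moment m i a v x : R :=
  integral01 (fun t => t ^+ m * v (contract i a t x)).

Lemma moment_integrand_continuous m i a v x : continuous v ->
  continuous (fun t : R => t ^+ m * v (contract i a t x)).
Proof.
move=> cv t.
exact: (cvgM (@exprn_continuous _ m t) (@contract_path_continuous v i a x cv t)).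
Qed.

Lemma moment_continuous m i a v : continuous v -> continuous (moment m i a v).
Proof.
move=> cv x; apply/(cvgrPdist_le (FF := nbhs_filter x)) => e e0.
near=> y.
have Hy : forall t : R, 0 <= t <= 1 ->
    `|v (contract i a t y) - v (contract i a t x)| <= e.
  by near: y; exact: contract_uniform.
have cm z := @moment_integrand_continuous m i a v z cv.
rewrite /moment -integral01_sub //; apply: integral01_normr_le.
  by move=> t; exact: (cvgB (cm x t) (cm y t)).
move=> t t01; rewrite -mulrBr normrM distrC -[leRHS]mul1r.
case/andP: (t01) => t0 t1.
by apply: ler_pM => //; [rewrite normrX ger0_norm // exprn_ile1 | exact: Hy].
Unshelve. all: by end_near. Qed.

(** Differentiation under the integral sign: the difference quotients of the
    integrand converge uniformly on the segment, by the mean value theorem and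
    [contract_uniform]. In the direction [i] the chain rule produces one more
    factor [t]. *)
Lemma is_derive_moment m i j a v x : class_C 1 v ->
  is_derive x (delta_mx 0 j) (moment m i a v)
    (moment (if j == i then m.+1 else m) i a (partial j v) x).
Proof.
move=> vC; have cv := class_C_continuous vC.
have cd : continuous (partial j v) by apply: class_C_continuous (class_C_partial j vC).
set m' := if _ then _ else _; set H := moment m' i a (partial j v) x.
pose al t : R := if j == i then t else 1.
have tm (t : R) : t ^+ m * al t = t ^+ m'.
  by rewrite /al /m'; case: (j == i); rewrite ?mulr1 // exprSr.
have dv y t : is_derive y (delta_mx 0 j) (fun y => v (contract i a t y))
    (al t * partial j v (contract i a t y)).
  exact: (is_derive_diag_affine (class_C_is_derive j (contract i a t y) vC)).
suff : (fun h : R => h^-1 *: ((moment m i a v \o shift x) (h *: delta_mx 0 j)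
     - moment m i a v x)) @ 0^' --> H.
  by move=> HH; split; [apply/cvg_ex; exists H | exact: cvg_lim HH].
apply/cvgrPdist_le => e e0.
have /nbhs_ballP[d /= d0 Hd] := contract_uniform i a x cd e0.
near=> h.
have h0 : h != 0 by near: h; exact: nbhs_dnbhs_neq.
have hd : `|h| < d.
  near: h; apply: dnbhs0_lt; exact: d0.
set y := h *: delta_mx 0 j + x.
rewrite (_ : H - _ = - (h^-1 * integral01 (fun t =>
    (t ^+ m * v (contract i a t y) - t ^+ m * v (contract i a t x)) -
    h * (t ^+ m' * partial j v (contract i a t x))))); last first.
  have cm w z : continuous w -> continuous (fun t : R => t ^+ m * w (contract i a t z)).
    exact: moment_integrand_continuous.
  rewrite integral01_sub; last 2 first.
  - by move=> t; exact: (cvgB (cm _ y cv t) (cm _ x cv t)).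
  - move=> t; exact: (cvgMl_tmp (@moment_integrand_continuous m' i a _ x cd t)).
  rewrite integral01_sub; [|exact: cm|exact: cm].
  rewrite integral01_scale; last exact: moment_integrand_continuous.
  by rewrite mulrBr mulKf // opprB; congr (_ - _).
rewrite normrN normrM normfV ler_pdivrMl ?normr_gt0 //.
apply: integral01_normr_le.
  move=> t; apply: cvgB.
    by apply: cvgB; exact: moment_integrand_continuous.
  exact: (cvgMl_tmp (@moment_integrand_continuous m' i a _ x cd t)).
move=> t t01.
have [s sh] := @mean_value _ (fun s : R => v (contract i a t (s *: delta_mx 0 j + x)))
  (fun s : R => al t * partial j v (contract i a t (s *: delta_mx 0 j + x))) h
  (fun s => (is_derive_line _ _ _ _ _).1 (dv (s *: delta_mx 0 j + x) t)).
rewrite scale0r add0r -/y -mulrBr => ->.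
rewrite -tm mulrCA -mulrBr normrM ler_wpM2l //.
rewrite [X in `|X|](_ : _ = t ^+ m' * (partial j v (contract i a t (s *: delta_mx 0 j + x))
   - partial j v (contract i a t x))); last by rewrite -tm; ring.
case/andP: (t01) => t0 t1.
rewrite normrM -[leRHS]mul1r; apply: ler_pM => //.
  by rewrite normrX ger0_norm // exprn_ile1.
apply: Hd => //; rewrite -ball_normE /= opprD addrCA subrr addr0 normrN.
apply: le_lt_trans (le_trans _ sh) hd.
by rewrite normrZ ler_piMr // norm_delta_le1.
Unshelve. all: by end_near. Qed.


Lemma class_C_moment k m i a v : class_C k v -> class_C k (moment m i a v).
Proof.
elim: k m v => [|k IHk] m v vC.
  by split=> //; exact: moment_continuous (class_C_continuous vC).
apply: class_CS; first exact: moment_continuous (class_C_continuous vC).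
move=> j; exists (moment (if j == i then m.+1 else m) i a (partial j v)).
split=> [x|]; last by apply: IHk; exact: class_C_partial.
by apply: is_derive_moment; exact: class_C_leq vC.
Qed.

Lemma moment_quotient i a u x : class_C 1 u ->
  (x 0 i - a 0 i) * moment 0 i a (partial i u) x = u x - u (contract i a 0 x).
Proof.
move=> uC; have cd : continuous (partial i u).
  exact: class_C_continuous (class_C_partial i uC).
rewrite /moment; under eq_fun do rewrite expr0 mul1r.
have cc := @contract_path_continuous _ i a x cd.
rewrite -integral01_scale //.
have dP (t : R) : is_derive t (1 : R) (fun t : R => u (contract i a t x))
    ((x 0 i - a 0 i) * partial i u (contract i a t x)).
  have /is_derive_line0 H := class_C_is_derive i (contract i a t x) uC.
  rewrite mulrC.
  have E : (fun s : R => u (contract i a s x)) =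
    (fun s => u ((x 0 i - a 0 i) * (s - t) *: delta_mx 0 i + contract i a t x)).
    apply/funext => s; rewrite [in LHS]contract_line [in RHS]contract_line.
    by rewrite addrA !scalerA -scalerDl; congr (u (_ *: _ + _)); ring.
  rewrite E.
  apply: (@is_derive1_comp _ (fun r => u (r *: delta_mx 0 i + contract i a t x))
    (fun s => (x 0 i - a 0 i) * (s - t))); first by rewrite subrr mulr0.
  have H2 : is_derive t (1 : R) (fun s : R => (x 0 i - a 0 i) * (s - t))
     ((x 0 i - a 0 i) *: (1 - 0)).
    exact: (@is_deriveZ _ _ _ (fun s => s - t)).
  by rewrite subr0 [_ *: 1]mulr1 in H2.
have cp : continuous (fun t => (x 0 i - a 0 i) * partial i u (contract i a t x)).
  by move=> t; exact: (cvgMl_tmp (cc t)).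
by rewrite (integral01_derive cp dP) contract1.
Qed.

Lemma contract_fix i a t x : x 0 i = a 0 i -> contract i a t x = x.
Proof.
by move=> xa; apply/rowP => j; rewrite contractE; case: eqP => // ->;
  rewrite xa subrr mulr0 addr0.
Qed.

(** Integration does not preserve definability, but this integral is a
    difference quotient outside of a hyperplane and a partial derivative on it.
    *)
Lemma dfun_moment_quotient (D : o_minimal_structure R) i a u : class_C 1 u ->
  definable_fun D u -> definable_fun D (moment 0 i a (partial i u)).
Proof.
move=> uC uD.
rewrite (_ : moment _ _ _ _ = fun x => if x 0 i == a 0 i then partial i u x
   else (u x - u (contract i a 0 x)) * (x 0 i - a 0 i)^-1).
  have dd : definable_fun D (fun x => x 0 i - a 0 i).
    by apply: dfun_sub; [exact: dfun_coord | exact: dfun_cst].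
  apply: (@dfun_if _ _ _ (fun x => x 0 i = a 0 i)).
  - by move=> x; exact: eqP.
  - by apply: dset_eq; [exact: dfun_coord | exact: dfun_cst].
  - by apply: dfun_partial => // x; case: uC => _ /(_ i) [].
  - apply: dfun_mul; last exact: dfun_inv.
    apply: dfun_sub => //; apply: dfun_comp => // k.
    apply: dfun_add; last exact: dfun_cst.
    by apply: dfun_mul; [exact: dfun_cst | exact: dfun_coord].
apply/funext => x; case: eqP => [xa|/eqP xa].
  rewrite /moment; under eq_fun do rewrite expr0 mul1r contract_fix //.
  exact: integral01_cst.
have xa0 : x 0 i - a 0 i != 0 by rewrite subr_eq0.
by apply: (mulfI xa0); rewrite moment_quotient // mulrCA mulfV // mulr1.
Qed.

Definition anchor k a : 'rV[R]_n -> 'rV[R]_n :=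
  diag_affine (fun j => if (j < k)%N then 0 else 1)
              (fun j => if (j < k)%N then a 0 j else 0).

Lemma anchorE k a x j : anchor k a x 0 j = if (j < k)%N then a 0 j else x 0 j.
Proof. by rewrite mxE; case: ifP => _; ring. Qed.

(** Hadamard's lemma, in the definable category. The point [x] is joined to [a]
    by changing one coordinate at a time, because the quotients of the
    increments by the coordinates are definable, whereas the integrals along the
    segment from [a] to [x] need not be. *)
Lemma hadamard (D : o_minimal_structure R) k u a : class_C k.+1 u ->
  definable_fun D u -> u a = 0 ->
  exists2 q : 'I_n -> 'rV[R]_n -> R,
    forall i, class_C k (q i) /\ definable_fun D (q i) &
    forall x, u x = \sum_i (x 0 i - a 0 i) * q i x.
Proof.
move=> uC uD ua; have uC1 : class_C 1 u by exact: class_C_leq uC.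
exists (fun i x => moment 0 i a (partial i u) (anchor i a x)) => [i|x].
  split.
    by apply: class_C_diag_affine; apply: class_C_moment; exact: class_C_partial.
  apply: dfun_comp; first exact: dfun_moment_quotient.
  move=> j; apply: dfun_add; last exact: dfun_cst.
  by apply: dfun_mul; [exact: dfun_cst | exact: dfun_coord].
have anchor0 : anchor 0 a x = x by apply/rowP => j; rewrite anchorE.
have anchorn : anchor n a x = a by apply/rowP => j; rewrite anchorE ltn_ord.
have : u x - u a = \sum_(0 <= i < n) - (u (anchor i.+1 a x) - u (anchor i a x)).
  by rewrite sumrN telescope_sumr // anchor0 anchorn opprB.
rewrite ua subr0 => ->; rewrite big_mkord; apply: eq_bigr => i _.
have xi : (anchor i a x) 0 i = x 0 i by rewrite anchorE ltnn.
rewrite -[in RHS]xi moment_quotient // opprB; congr (_ - u _).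
apply/rowP => j; rewrite contractE !anchorE ltnS ltnn mul0r addr0.
by rewrite leq_eqVlt val_eqE; case: (eqVneq j i) => [->|].
Qed.

End Hadamard.

(** * Sums of squares *)

Section SumsOfSquares.
Variables (R : realType) (D : o_minimal_structure R) (n k : nat).
Implicit Types (u v w : 'rV[R]_n -> R).

Definition def_class u := definable_fun D u /\ class_C k u.

Lemma def_class_cst (c : R) : def_class (fun=> c).
Proof. by split; [exact: dfun_cst | exact: class_C_cst]. Qed.

Lemma def_class_coord i : def_class (fun x => x 0 i).
Proof. by split; [exact: dfun_coord | exact: class_C_coord]. Qed.

Lemma def_class_add u v :
  def_class u -> def_class v -> def_class (fun x => u x + v x).
Proof. by move=> [? ?] [? ?]; split; [exact: dfun_add | exact: class_C_add]. Qed.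

Lemma def_class_sub u v :
  def_class u -> def_class v -> def_class (fun x => u x - v x).
Proof. by move=> [? ?] [? ?]; split; [exact: dfun_sub | exact: class_C_sub]. Qed.

Lemma def_class_opp u : def_class u -> def_class (fun x => - u x).
Proof. by move=> [? ?]; split; [exact: dfun_opp | exact: class_C_opp]. Qed.

Lemma def_class_mul u v :
  def_class u -> def_class v -> def_class (fun x => u x * v x).
Proof. by move=> [? ?] [? ?]; split; [exact: dfun_mul | exact: class_C_mul]. Qed.

Lemma def_class_exp u j : def_class u -> def_class (fun x => u x ^+ j).
Proof. by move=> [? ?]; split; [exact: dfun_exp | exact: class_C_exp]. Qed.

Lemma def_class_sum (I : Type) (s : seq I) (P : pred I) (u : I -> 'rV[R]_n -> R) :
  (forall i, def_class (u i)) -> def_class (fun x => \sum_(i <- s | P i) u i x).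
Proof.
by move=> du; split; [apply: dfun_sum | apply: class_C_sum] => i;
  have [] := du i.
Qed.

Lemma def_class_inv u : (forall x, u x != 0) -> def_class u ->
  def_class (fun x => (u x)^-1).
Proof. by move=> u0 [? ?]; split; [exact: dfun_inv | exact: class_C_inv]. Qed.

Lemma def_class_sqrtpow j u : (k.*2 < j)%N -> def_class u ->
  def_class (fun x => sqrtpow j (u x)).
Proof.
move=> kj [? ?]; split; last exact: class_C_sqrtpow.
by apply: dfun_exp; exact: dfun_sqrt.
Qed.

Local Notation sos u := (@sum_of_squares R D n k u).

Lemma sos_ext u v : u =1 v -> sos u -> sos v.
Proof. by move=> /funext ->. Qed.

Lemma sos_sqr u : def_class u -> sos (fun x => u x ^+ 2).
Proof.
by move=> du; exists 1%N, (fun=> u); split=> [//|x]; rewrite big_ord1.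
Qed.

Lemma sos_cst (c : R) : 0 <= c -> sos (fun=> c).
Proof.
move=> c0; apply: sos_ext (sos_sqr (def_class_cst (Num.sqrt c))) => x.
by rewrite sqr_sqrtr.
Qed.

Lemma sos_add u v : sos u -> sos v -> sos (fun x => u x + v x).
Proof.
move=> [N [q [dq qE]]] [M [r [dr rE]]].
exists (N + M)%N, (fun i => match fintype.split i with inl a => q a | inr b => r b end).
split=> [i|x]; first by case: (fintype.split i).
rewrite big_split_ord /= qE rE; congr (_ + _); apply: eq_bigr => i _.
  by rewrite split_lshift.
by rewrite split_rshift.
Qed.

Lemma sos_sum (I : Type) (s : seq I) (P : pred I) (u : I -> 'rV[R]_n -> R) :
  (forall i, sos (u i)) -> sos (fun x => \sum_(i <- s | P i) u i x).
Proof.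
move=> su; elim: s => [|i s IHs].
  by apply: sos_ext (sos_cst (lexx 0)) => x; rewrite big_nil.
case: (boolP (P i)) => Pi.
  by apply: sos_ext (sos_add (su i) IHs) => x; rewrite big_cons Pi.
by apply: sos_ext IHs => x; rewrite big_cons (negbTE Pi).
Qed.

Lemma sos_mul u v : sos u -> sos v -> sos (fun x => u x * v x).
Proof.
move=> [N [q [dq qE]]] [M [r [dr rE]]].
apply: (@sos_ext (fun x => \sum_i \sum_j (q i x * r j x) ^+ 2)) => [x|].
  rewrite qE rE mulr_suml; apply: eq_bigr => i _; rewrite mulr_sumr.
  by apply: eq_bigr => j _; rewrite exprMn.
by apply: sos_sum => i; apply: sos_sum => j; apply: sos_sqr; exact: def_class_mul.
Qed.

Lemma sos_prod (I : Type) (s : seq I) (P : pred I) (u : I -> 'rV[R]_n -> R) :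
  (forall i, sos (u i)) -> sos (fun x => \prod_(i <- s | P i) u i x).
Proof.
move=> su; elim: s => [|i s IHs].
  by apply: sos_ext (sos_cst ler01) => x; rewrite big_nil.
case: (boolP (P i)) => Pi.
  by apply: sos_ext (sos_mul (su i) IHs) => x; rewrite big_cons Pi.
by apply: sos_ext IHs => x; rewrite big_cons (negbTE Pi).
Qed.

Lemma sos_def_class u : sos u -> def_class u.
Proof.
move=> [N [q [dq /funext ->]]]; apply: def_class_sum => i.
exact/def_class_exp/dq.
Qed.

Lemma sos_ge0 u x : sos u -> 0 <= u x.
Proof. by move=> [N [q [_ ->]]]; apply: sumr_ge0 => i _; exact: sqr_ge0. Qed.

End SumsOfSquares.

(** * Gluing certificates *)

Section Certificates.
Variables (R : realType) (D : o_minimal_structure R) (n l m k : nat).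
Variables (F : 'rV[R]_n -> R) (g : 'I_l -> 'rV[R]_n -> R) (h : 'I_m -> 'rV[R]_n -> R).
Hypotheses (F_def : def_class D k F) (g_def : forall i, def_class D k (g i))
  (h_def : forall j, def_class D k (h j)).
Implicit Types (chi : 'rV[R]_n -> R).

Local Notation sos u := (@sum_of_squares R D n k u).

(** The multipliers [chi] for which [chi * F] lies in the quadratic module
    generated by the [g i], the [h j] and the [- h j]. *)
Definition certified chi := exists s0 s t,
  [/\ sos s0, (forall i : 'I_l, sos (s i)), (forall j : 'I_m, def_class D k (t j)) &
   forall x, chi x * F x = s0 x + \sum_i s i x * g i x + \sum_j t j x * h j x].

Lemma certified_ext chi chi' : chi =1 chi' -> certified chi -> certified chi'.
Proof. by move=> /funext ->. Qed.

Lemma certified0 : certified (fun=> 0).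
Proof.
exists (fun=> 0), (fun _ _ => 0), (fun _ _ => 0).
split=> [|i|j|x]; try exact: sos_cst; first exact: def_class_cst.
by rewrite mul0r !big1 ?addr0 // => i _; rewrite mul0r.
Qed.

Lemma certified_add chi chi' :
  certified chi -> certified chi' -> certified (fun x => chi x + chi' x).
Proof.
move=> [s0 [s [t [s0P sP tP E]]]] [s0' [s' [t' [s0P' sP' tP' E']]]].
exists (fun x => s0 x + s0' x), (fun i x => s i x + s' i x),
  (fun j x => t j x + t' j x).
split=> [|i|j|x]; [exact: sos_add|exact: sos_add|exact: def_class_add|].
rewrite mulrDl E E'.
under [in RHS]eq_bigr do rewrite mulrDl.
under [X in _ = _ + X]eq_bigr do rewrite mulrDl.
by rewrite !big_split /=; ring.
Qed.

Lemma certified_sum (I : Type) (r : seq I) (chi : I -> 'rV[R]_n -> R) :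
  (forall i, certified (chi i)) -> certified (fun x => \sum_(i <- r) chi i x).
Proof.
move=> cchi; elim: r => [|i r IHr].
  by apply: certified_ext certified0 => x; rewrite big_nil.
by apply: certified_ext (certified_add (cchi i) IHr) => x; rewrite big_cons.
Qed.

Lemma certified_mul s chi : sos s -> certified chi ->
  certified (fun x => s x * chi x).
Proof.
move=> sP [s0 [r [t [s0P rP tP E]]]].
exists (fun x => s x * s0 x), (fun i x => s x * r i x),
  (fun j x => s x * t j x).
have sd := sos_def_class sP.
split=> [|i|j|x]; [exact: sos_mul|exact: sos_mul|exact: def_class_mul|].
rewrite -mulrA E !mulrDr !mulr_sumr; congr (_ + _ + _);
  by apply: eq_bigr => i _; rewrite mulrA.
Qed.

(* the least exponent for which [sqrtpow] is of class C^k *)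
Let J := k.*2.+1.

(** The product of [F] and of a power of its positive part is again such a
    power, hence a square. *)
Lemma certified_pos : certified (fun x => sqrtpow J (F x) ^+ 2).
Proof.
exists (fun x => sqrtpow J.+1 (F x) ^+ 2), (fun _ _ => 0), (fun _ _ => 0).
split=> [|i|j|x].
- by apply/sos_sqr/def_class_sqrtpow => //; rewrite ltnS.
- exact: sos_cst.
- exact: def_class_cst.
rewrite !big1 ?addr0; [|by move=> i _; rewrite mul0r..].
rewrite !expr2 [LHS]mulrC mulrA sqrtpow_mul // /sqrtpow -!exprD.
by congr (_ ^+ _); rewrite !addSn !addnS.
Qed.

(** Where [g i < 0] an arbitrary [F] is dealt with by writing it as the
    difference of the squares of [(F + 1) / 2] and [(F - 1) / 2]. *)
Lemma certified_ineq i : certified (fun x => sqrtpow J.+1 (- g i x) ^+ 2).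
Proof.
pose a (c : R) x := (F x + c) / 2.
have da c : def_class D k (a c).
  apply: def_class_mul; last exact: def_class_cst.
  by apply: def_class_add => //; exact: def_class_cst.
have dg j : (k.*2 < j)%N -> def_class D k (fun x => sqrtpow j (- g i x)).
  by move=> kj; apply: def_class_sqrtpow => //; exact: def_class_opp.
exists (fun x => (a 1 x * sqrtpow J.+1 (- g i x)) ^+ 2),
  (fun i' x => if i' == i then (a (-1) x * sqrtpow J (- g i x)) ^+ 2 else 0),
  (fun _ _ => 0).
split=> [|i'|j|x].
- by apply/sos_sqr/def_class_mul => //; apply: dg; rewrite ltnS.
- case: eqP => _; last exact: sos_cst.
  by apply/sos_sqr/def_class_mul => //; apply: dg.
- exact: def_class_cst.
rewrite [X in _ = _ + X]big1 ?addr0; last by move=> j _; rewrite mul0r.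
rewrite (bigD1 i) //= eqxx big1 ?addr0; last first.
  by move=> i' /negbTE ->; rewrite mul0r.
have E : sqrtpow J.+1 (- g i x) ^+ 2 = - g i x * sqrtpow J (- g i x) ^+ 2.
  rewrite [in RHS]expr2 mulrA sqrtpow_mul // /sqrtpow expr2 -!exprD.
  by congr (_ ^+ _); rewrite !addSn !addnS.
rewrite (exprMn 2 (a 1 x)) E (exprMn 2 (a (-1) x)) /a.
by move: (sqrtpow _ _) => s; field.
Qed.

Lemma certified_eq j : certified (fun x => h j x ^+ 2).
Proof.
exists (fun=> 0), (fun _ _ => 0), (fun j' x => if j' == j then h j x * F x else 0).
split=> [|i|j'|x].
- exact: sos_cst.
- exact: sos_cst.
- by case: eqP => _; [exact: def_class_mul | exact: def_class_cst].
rewrite add0r big1 ?add0r; last by move=> i _; rewrite mul0r.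
rewrite (bigD1 j) //= eqxx big1 ?addr0; last first.
  by move=> i' /negbTE ->; rewrite mul0r.
by ring.
Qed.

(** The sum [d] of sufficiently many certified multipliers is positive
    everywhere: at a common zero of [certified_pos], [certified_ineq] and
    [certified_eq] the point is feasible and [F] vanishes, and the remaining
    multipliers take care of such points. Dividing the certificate of [d] by [d]
    amounts to multiplying it by the sum of squares [d^-2 * d]. *)
Lemma certified_glue (A : seq 'rV[R]_n) :
  (forall x, feasible g h x -> 0 <= F x) ->
  (forall x, feasible g h x -> F x = 0 -> x \in A) ->
  (forall a, a \in A -> exists chi, [/\ sos chi, certified chi & 0 < chi a]) ->
  certified (fun=> 1).
Proof.
move=> F_ge0 FA cA.
pose P a (chi : 'rV[R]_n -> R) :=
  [/\ sos chi, certified chi & a \in A -> 0 < chi a].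
have /choice[chi chiP] : forall a, exists chi, P a chi.
  move=> a; have [/cA[chi [? ? ?]]|aA] := boolP (a \in A); first by exists chi.
  by exists (fun=> 0); split; [exact: sos_cst | exact: certified0 | rewrite (negbTE aA)].
pose d x := sqrtpow J (F x) ^+ 2 + \sum_i sqrtpow J.+1 (- g i x) ^+ 2 +
  \sum_j h j x ^+ 2 + \sum_(a <- A) chi a x.
have d_cert : certified d.
  apply: certified_add.
    apply: certified_add; last by apply: certified_sum; exact: certified_eq.
    apply: certified_add; first exact: certified_pos.
    by apply: certified_sum; exact: certified_ineq.
  by apply: certified_sum => a; have [] := chiP a.
have d_sos : sos d.
  apply: sos_add.
    apply: sos_add; last by apply: sos_sum => j; exact: sos_sqr.
    apply: sos_add; first exact/sos_sqr/def_class_sqrtpow.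
    apply: sos_sum => i; apply/sos_sqr/def_class_sqrtpow; first by rewrite ltnS.
    exact: def_class_opp.
  by apply: sos_sum => a; have [] := chiP a.
have d_gt0 x : 0 < d x.
  rewrite /d; set s1 := _ ^+ 2; set s2 := \sum_i _; set s3 := \sum_i _.
  set s4 := \sum_(a <- A) _.
  have s1_ge0 : 0 <= s1 by exact: sqr_ge0.
  have s2_ge0 : 0 <= s2 by apply: sumr_ge0 => i _; exact: sqr_ge0.
  have s3_ge0 : 0 <= s3 by apply: sumr_ge0 => i _; exact: sqr_ge0.
  have chi_ge0 a : 0 <= chi a x by have [/sos_ge0] := chiP a.
  have s4_ge0 : 0 <= s4 by exact: sumr_ge0.
  have [Fx|Fx] := ltP 0 (F x).
    have : 0 < s1 by rewrite exprn_gt0 // sqrtpow_gt0.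
    lra.
  have [xS|xS] := pselect (feasible g h x).
    have xA : x \in A by apply: FA => //; apply/eqP; rewrite eq_le Fx F_ge0.
    have : 0 < s4.
      rewrite /s4 (big_rem x) //= ltr_pwDl //; last exact: sumr_ge0.
      by have [_ _] := chiP x; apply.
    lra.
  have : (exists i, g i x < 0) \/ (exists j, h j x != 0).
    apply: contrapT => H; apply: xS; split=> [i|j].
      by rewrite leNgt; apply/negP => gi; apply: H; left; exists i.
    by apply/eqP; apply: contrapT => /negP hj; apply: H; right; exists j.
  case=> [[i gi]|[j hj]].
    suff : 0 < s2 by lra.
    rewrite /s2 (bigD1 i) //= ltr_pwDl //; last by apply: sumr_ge0 => ? _; exact: sqr_ge0.
    by rewrite exprn_gt0 // sqrtpow_gt0 // oppr_gt0.
  suff : 0 < s3 by lra.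
  rewrite /s3 (bigD1 j) //= ltr_pwDl //; last by apply: sumr_ge0 => ? _; exact: sqr_ge0.
  by rewrite exprn_even_gt0.
have dV : sos (fun x => ((d x)^-1) ^+ 2).
  apply/sos_sqr/def_class_inv; last exact: sos_def_class.
  by move=> x; rewrite gt_eqF.
apply: certified_ext (certified_mul (sos_mul dV d_sos) d_cert) => x.
by rewrite expr2; have := d_gt0 x; move: (d x) => y y0; field; rewrite gt_eqF.
Qed.

End Certificates.

(** * Compactness and positive definite forms *)

Section Compactness.
Variable R : realType.

Definition sqnorm n (x : 'rV[R]_n) : R := \sum_i x 0 i ^+ 2.

Lemma sqnorm_ge0 n (x : 'rV[R]_n) : 0 <= sqnorm x.
Proof. by apply: sumr_ge0 => i _; exact: sqr_ge0. Qed.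

Lemma sqr_coord_le n (x : 'rV[R]_n) i : x 0 i ^+ 2 <= sqnorm x.
Proof.
by rewrite /sqnorm (bigD1 i) //= lerDl; apply: sumr_ge0 => j _; exact: sqr_ge0.
Qed.

Lemma sqnorm_eq0 n (x : 'rV[R]_n) : sqnorm x = 0 -> x = 0.
Proof.
move=> x0; apply/rowP => i; rewrite mxE; apply/eqP.
by rewrite -sqrf_eq0 eq_le sqr_ge0 -x0 sqr_coord_le.
Qed.

Lemma sqnorm_gt0 n (x : 'rV[R]_n) : x != 0 -> 0 < sqnorm x.
Proof.
by move=> x0; rewrite lt_def sqnorm_ge0 andbT; apply: contra_neq x0 => /sqnorm_eq0.
Qed.

Lemma sqnorm0 n : sqnorm (0 : 'rV[R]_n) = 0.
Proof. by rewrite /sqnorm big1 // => i _; rewrite mxE expr0n. Qed.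

Lemma sqnormZ n (t : R) (x : 'rV[R]_n) : sqnorm (t *: x) = t ^+ 2 * sqnorm x.
Proof. by rewrite /sqnorm mulr_sumr; apply: eq_bigr => i _; rewrite mxE exprMn. Qed.

Lemma class_C_sqdist n k (a : 'rV[R]_n) : class_C k (fun x : 'rV[R]_n => sqnorm (x - a)).
Proof.
rewrite /sqnorm; under eq_fun do under eq_bigr do rewrite 2!mxE.
apply: class_C_sum => i; apply: class_C_exp; apply: class_C_add.
  exact: class_C_coord.
exact: class_C_cst.
Qed.

Lemma sqdist_continuous n (a : 'rV[R]_n) : continuous (fun x : 'rV[R]_n => sqnorm (x - a)).
Proof. exact: class_C_continuous (class_C_sqdist 0 a). Qed.

Lemma closed_ball_compact n (a : 'rV[R]_n) (r : R) :
  compact [set x : 'rV[R]_n | sqnorm (x - a) <= r].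
Proof.
apply: bounded_closed_compact; last first.
  apply: (@preimage_closed _ _ _ [set y | y <= r]); last exact: closed_le.
  by move=> x _; exact: sqdist_continuous.
exists (`|a| + (1 + r)); split; first exact: num_real.
move=> M ltM x /= xr; apply: le_trans (ltW ltM).
rewrite -[x](subrK a) addrC; apply: le_trans (ler_normD _ _) _; rewrite lerD2l.
have r0 : 0 <= r := le_trans (sqnorm_ge0 _) xr.
rewrite [leLHS]mx_normrE; apply/bigmax_leP; split=> [|[l i] _ /=]; first lra.
rewrite (ord1 l); move: (le_trans (sqr_coord_le (x - a) i) xr).
move: ((x - a) 0 i) => y yr; rewrite ler_norml; apply/andP; split; nra.
Qed.

Lemma sphere_compact n (a : 'rV[R]_n) (r : R) :
  compact [set x : 'rV[R]_n | sqnorm (x - a) = r].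
Proof.
apply: (subclosed_compact _ (@closed_ball_compact n a r)); last first.
  by move=> x /= ->.
apply: (@preimage_closed _ _ _ [set y | y = r]); last exact: closed_eq.
by move=> x _; exact: sqdist_continuous.
Qed.

Lemma compact_min n (K : set 'rV[R]_n) (f : 'rV[R]_n -> R) :
  compact K -> K !=set0 -> continuous f ->
  exists2 x, K x & forall y, K y -> f x <= f y.
Proof.
move=> cK K0 cf.
have [x xK xmin] := compact_EVT_min K0 cK (continuous_subspaceT cf).
by exists x => [|y yK]; [rewrite inE in xK | apply: xmin; rewrite inE].
Qed.

(** Penalization on a compact set: what is needed of [u] only where [v] vanishes
    is obtained everywhere by adding a large multiple of [v]. *)
Lemma penalty n (K : set 'rV[R]_n) (u v : 'rV[R]_n -> R) :
  compact K -> continuous u -> continuous v -> (forall x, 0 <= v x) ->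
  (forall x, K x -> v x = 0 -> 0 < u x) ->
  exists2 c, 0 <= c & forall x, K x -> 0 < u x + c * v x.
Proof.
move=> cK cu cv v0 uv; pose K1 := K `&` [set x | u x <= 0].
have cK1 : compact K1.
  apply: compact_closedI => //.
  apply: (@preimage_closed _ _ u [set y | y <= 0]); last exact: closed_le.
  by move=> x _; exact: cu.
have [K10|/set0P/negP/negPn/eqP K10] := pselect (K1 !=set0); last first.
  exists 0 => // x Kx; rewrite mul0r addr0 ltNge; apply/negP => ux.
  by have : K1 x by []; rewrite K10.
have [x1 [Kx1 ux1] min1] := compact_min cK1 K10 cv.
have [x2 [Kx2 ux2] min2] := compact_min cK1 K10 cu.
have vx1 : 0 < v x1.
  rewrite lt_def v0 andbT; apply/eqP => /(uv _ Kx1).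
  by rewrite ltNge (ux1 : u x1 <= 0).
have c0 : 0 <= (1 - u x2) / v x1.
  by rewrite divr_ge0 // subr_ge0 (le_trans (ux2 : u x2 <= 0)).
exists ((1 - u x2) / v x1) => // x Kx.
have [ux|ux] := ltP 0 (u x); first by rewrite ltr_pwDl // mulr_ge0.
have H1 := min1 x (conj Kx ux); have H2 := min2 x (conj Kx ux).
have : (1 - u x2) / v x1 * v x1 <= (1 - u x2) / v x1 * v x by rewrite ler_wpM2l.
by rewrite divfK ?gt_eqF //; lra.
Qed.

(** Finsler's lemma: a form which is positive on the kernel of [p] becomes
    positive definite after penalization on the unit sphere. The lower bound
    leaves room for a perturbation of the form. *)
Lemma finsler n (q p : 'rV[R]_n -> R) :
  continuous q -> continuous p ->
  (forall t v, q (t *: v) = t ^+ 2 * q v) ->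
  (forall t v, p (t *: v) = t ^+ 2 * p v) ->
  (forall v, 0 <= p v) -> (forall v, v != 0 -> p v = 0 -> 0 < q v) ->
  exists c kappa, 0 < kappa /\ forall v, kappa * sqnorm v <= q v + c * p v.
Proof.
move=> cq cp qZ pZ p0 pq; pose K := [set v : 'rV[R]_n | sqnorm (v - 0) = 1].
have cK : compact K by exact: sphere_compact.
have KN0 v : K v -> v != 0.
  move=> Kv; apply/eqP => v0; move: Kv; rewrite /K /= v0 subr0 sqnorm0.
  by move/eqP; rewrite eq_sym oner_eq0.
have [c c0 qcp] : exists2 c, 0 <= c & forall v, K v -> 0 < q v + c * p v.
  by apply: penalty => // v /KN0; exact: pq.
have cqp : continuous (fun v => q v + c * p v).
  by move=> v; exact: (cvgD (cq v) (cvgMl_tmp (cp v))).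
have [kappa kappa0 Hk] : exists2 kappa, 0 < kappa &
    forall v, K v -> kappa <= q v + c * p v.
  have [K0|/set0P/negP/negPn/eqP K0] := pselect (K !=set0).
    have [v0 Kv0 minv] := compact_min cK K0 cqp.
    by exists (q v0 + c * p v0); [exact: qcp | exact: minv].
  by exists 1 => // v Kv; have : K v by []; rewrite K0.
exists c, kappa; split=> // v.
have [->|v0] := eqVneq v 0.
  rewrite sqnorm0 mulr0 -(scale0r (0 : 'rV[R]_n)) qZ pZ expr0n !mul0r mulr0.
  by rewrite addr0.
have sv := sqnorm_gt0 v0; pose s := Num.sqrt (sqnorm v).
have s0 : 0 < s by rewrite sqrtr_gt0.
have sE : s ^+ 2 = sqnorm v by rewrite sqr_sqrtr // ltW.
have /Hk : K (s^-1 *: v).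
  by rewrite /K /= subr0 sqnormZ -sE -exprMn mulVf ?expr1n // gt_eqF.
rewrite qZ pZ mulrCA -mulrDr exprVn mulrC ler_pdivlMr ?exprn_gt0 //.
by rewrite sE.
Qed.

End Compactness.

Section Cholesky.
Variable R : realType.

(** Completing the square, one variable at a time. *)
Lemma cholesky n (A : 'I_n -> 'I_n -> R) :
  (forall x : 'I_n -> R, (exists i, x i != 0) ->
     0 < \sum_i \sum_j A i j * (x i * x j)) ->
  exists (N : nat) (L : 'I_N -> 'I_n -> R), forall x : 'I_n -> R,
    \sum_i \sum_j A i j * (x i * x j) = \sum_r (\sum_i L r i * x i) ^+ 2.
Proof.
elim: n A => [|n IHn] A Apos.
  by exists 0%N, (fun _ _ => 0) => x; rewrite !big_ord0.
pose a := A ord0 ord0.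
pose s i := (A ord0 (lift ord0 i) + A (lift ord0 i) ord0) / 2.
pose A' i j := A (lift ord0 i) (lift ord0 j) - s i * s j / a.
have formE x : a != 0 -> \sum_i \sum_j A i j * (x i * x j) =
    a * (x ord0 + (\sum_i s i * x (lift ord0 i)) / a) ^+ 2 +
    \sum_i \sum_j A' i j * (x (lift ord0 i) * x (lift ord0 j)).
  move=> a0.
  have -> : \sum_i \sum_j A' i j * (x (lift ord0 i) * x (lift ord0 j)) =
     \sum_i \sum_j A (lift ord0 i) (lift ord0 j) * (x (lift ord0 i) * x (lift ord0 j))
     - (\sum_i s i * x (lift ord0 i)) ^+ 2 / a.
    rewrite expr2 mulr_suml mulr_suml -sumrB; apply: eq_bigr => i _.
    rewrite mulr_sumr mulr_suml -sumrB; apply: eq_bigr => j _.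
    by rewrite /A'; ring.
  have -> : \sum_i \sum_j A i j * (x i * x j) = a * x ord0 ^+ 2 +
     2 * x ord0 * (\sum_i s i * x (lift ord0 i)) +
     \sum_i \sum_j A (lift ord0 i) (lift ord0 j) * (x (lift ord0 i) * x (lift ord0 j)).
    rewrite big_ord_recl big_ord_recl /=.
    under [X in _ + X = _]eq_bigr do rewrite big_ord_recl /=.
    rewrite big_split /= mulr_sumr !addrA; congr (_ + _).
    rewrite -!addrA expr2; congr (_ + _); rewrite -big_split /=.
    by apply: eq_bigr => i _; rewrite /s; field.
  by field.
have a_gt0 : 0 < a.
  have := Apos (fun i => (i == ord0)%:R); rewrite big_ord_recl /=.
  rewrite big_ord_recl /= big1 => [|i _]; last by rewrite !mulr0.
  rewrite big1 => [|i _]; last first.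
    by rewrite big1 // => j _; rewrite mul0r mulr0.
  by rewrite !mulr1 !addr0; apply; exists ord0; rewrite eqxx oner_neq0.
have a0 : a != 0 by rewrite gt_eqF.
have [|N [L LE]] := IHn A'.
  move=> x [i xi].
  pose y j := if unlift ord0 j is Some j' then x j' else - (\sum_i s i * x i) / a.
  have yl j : y (lift ord0 j) = x j by rewrite /y liftK.
  have y0 : y ord0 = - (\sum_i s i * x i) / a by rewrite /y unlift_none.
  have ys : \sum_i s i * y (lift ord0 i) = \sum_i s i * x i.
    by apply: eq_bigr => j _; rewrite yl.
  have := Apos y; rewrite formE // y0 ys.
  under [X in _ + X]eq_bigr do under eq_bigr do rewrite !yl.
  rewrite mulNr addNr expr0n mulr0 add0r; apply.
  by exists (lift ord0 i); rewrite yl.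
exists N.+1, (fun r i => if unlift ord0 r is Some r' then
    (if unlift ord0 i is Some i' then L r' i' else 0)
  else Num.sqrt a * (if unlift ord0 i is Some i' then s i' / a else 1)) => x.
rewrite formE // LE [RHS]big_ord_recl unlift_none; congr (_ + _).
  rewrite big_ord_recl unlift_none /= mulr1.
  under [in RHS]eq_bigr do rewrite liftK -mulrA.
  rewrite -mulr_sumr -mulrDr exprMn sqr_sqrtr ?ltW //.
  congr (_ * (_ + _) ^+ 2); rewrite mulr_suml; apply: eq_bigr => i _; ring.
apply: eq_bigr => r _; rewrite liftK big_ord_recl unlift_none mul0r add0r.
by under [in RHS]eq_bigr do rewrite liftK.
Qed.

End Cholesky.

(** * The Karush-Kuhn-Tucker conditions *)

Section KKT.
Variables (R : realType) (n l m : nat).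
Variables (f : 'rV[R]_n -> R) (g : 'I_l -> 'rV[R]_n -> R) (h : 'I_m -> 'rV[R]_n -> R).

Lemma is_derive_sumf (I : finType) (u : I -> 'rV[R]_n -> R) (d : I -> R)
    (x v : 'rV[R]_n) : (forall i, is_derive x v (u i) (d i)) ->
  is_derive x v (fun y => \sum_i u i y) (\sum_i d i).
Proof.
move=> du; elim: (index_enum I) => [|i s IHs].
  by rewrite big_nil; under eq_fun do rewrite big_nil; exact: is_derive_cst.
by rewrite big_cons; under eq_fun do rewrite big_cons; exact: is_deriveD.
Qed.

Lemma is_derive_sqr (u : 'rV[R]_n -> R) (x v : 'rV[R]_n) (d : R) :
  is_derive x v u d -> is_derive x v (fun y => u y ^+ 2) (2 * u x * d).
Proof.
move=> du; have := is_deriveX 2 du; rewrite exprfctE => H.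
by apply: is_derive_eq H _; rewrite expr1.
Qed.

(** The coefficients are indexed like the vectors, not by the positions in the
    sequence, so that this applies to the concatenation of two families. *)
Lemma free_coef0 (V : vectType R) (I : eqType) (s : seq I) (v : I -> V) (c : I -> R) :
  free [seq v i | i <- s] -> \sum_(i <- s) c i *: v i = 0 ->
  forall i, i \in s -> c i = 0.
Proof.
elim: s => //= i s IHs; rewrite free_cons => /andP[vi fs].
rewrite big_cons => cv.
have ci : c i = 0.
  apply/eqP; apply: contraNT vi => ci.
  have -> : v i = - ((c i)^-1 *: \sum_(j <- s) c j *: v j).
    move/eqP: cv; rewrite addr_eq0 => /eqP cv.
    by rewrite -scalerN -cv scalerA mulVf // scale1r.
  rewrite memvN memvZ // big_seq memv_suml // => j js.
  by rewrite memvZ // memv_span // map_f.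
move: cv; rewrite ci scale0r add0r => cv j; rewrite inE => /orP[/eqP->//|].
exact: IHs.
Qed.

Lemma regular_coef0 x (al : 'I_l -> R) (be : 'I_m -> R) : regular_at g h x ->
  (forall i, g i x != 0 -> al i = 0) ->
  \sum_i al i *: gradient (g i) x + \sum_j be j *: gradient (h j) x = 0 ->
  (forall i, al i = 0) /\ (forall j, be j = 0).
Proof.
move=> reg al0 E.
pose v (s : 'I_l + 'I_m) := match s with
  inl i => gradient (g i) x | inr j => gradient (h j) x end.
pose c (s : 'I_l + 'I_m) := match s with inl i => al i | inr j => be j end.
pose s := [seq inl i | i <- enum (active g x)] ++ [seq inr j | j <- enum 'I_m]
   : seq ('I_l + 'I_m)%type.
have fs : free [seq v i | i <- s].
  rewrite map_cat -(map_comp v inl) -(map_comp v inr).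
  exact: reg.
have cs : \sum_(i <- s) c i *: v i = 0.
  apply: etrans E; rewrite big_cat /= big_map big_map; congr (_ + _); last first.
    by rewrite big_enum.
  rewrite big_enum /= [RHS](bigID (mem (active g x))) /= [X in _ = _ + X]big1 ?addr0 //.
  by move=> i; rewrite inE => /al0 ->; rewrite scale0r.
have H := free_coef0 fs cs; split=> [i|j].
  have [gi|/al0//] := eqVneq (g i x) 0.
  apply: (H (inl i)); rewrite mem_cat map_f // mem_enum inE.
  exact/eqP.
by apply: (H (inr j)); rewrite mem_cat orbC map_f // mem_enum.
Qed.

Hypotheses (fC : class_C 1 f) (gC : forall i, class_C 1 (g i))
  (hC : forall j, class_C 1 (h j)).
Variable a : 'rV[R]_n.
Hypotheses (a_feasible : feasible g h a)
  (a_min : forall x, feasible g h x -> f a <= f x).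

(** The penalized objective [w] is positive on the sphere and vanishes at [a],
    so that it is minimal at an interior point of the ball; the multipliers are
    read off the gradient of the penalty there. The term [sqnorm (x - a)] makes
    [a] a strict minimizer. *)
Lemma approximate_KKT (d : R) : 0 < d -> exists x lambda nu,
  [/\ sqnorm (x - a) < d ^+ 2, forall i, 0 <= lambda i,
      forall i, 0 < g i x -> lambda i = 0 &
      forall j, partial j f x + 2 * (x 0 j - a 0 j) =
        \sum_(i : 'I_l) lambda i * partial j (g i) x +
        \sum_(i : 'I_m) nu i * partial j (h i) x].
Proof.
move=> d0.
pose u x := f x - f a + sqnorm (x - a).
pose v x := \sum_i sqrtpow 4 (- g i x) + \sum_j h j x ^+ 2.
have cf := class_C_continuous fC.
have vC : class_C 1 v.
  apply: class_C_add; apply: class_C_sum => i; last exact: class_C_exp.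
  exact: (class_C_sqrtpow (isT : (1.*2 < 4)%N) (class_C_opp (gC i))).
have uC : class_C 1 u.
  apply: class_C_add; last exact: class_C_sqdist.
  exact: (class_C_sub fC (class_C_cst n 1 (f a))).
have v_ge0 x : 0 <= v x.
  by rewrite addr_ge0 // sumr_ge0 // => i _; [exact: sqrtpow_ge0 | exact: sqr_ge0].
have v_eq0 x : v x = 0 -> feasible g h x.
  move/eqP; rewrite paddr_eq0; last 2 first.
  - by rewrite sumr_ge0 // => i _; exact: sqrtpow_ge0.
  - by rewrite sumr_ge0 // => i _; exact: sqr_ge0.
  rewrite psumr_eq0 => [|i _]; last exact: sqrtpow_ge0.
  rewrite psumr_eq0 => [|i _]; last exact: sqr_ge0.
  move=> /andP[/allP gx /allP hx]; split=> [i|j].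
    rewrite leNgt -oppr_gt0 -(@sqrtpow_gt0 _ 4) //.
    by have := gx i; rewrite mem_index_enum => /(_ isT)/eqP ->; rewrite ltxx.
  by have := hx j; rewrite mem_index_enum => /(_ isT); rewrite sqrf_eq0 => /eqP.
have va : v a = 0.
  case: a_feasible => ga ha; rewrite /v !big1 ?addr0 // => [j _|i _].
    by rewrite ha expr0n.
  by rewrite /sqrtpow ler0_sqrtr ?expr0n // oppr_le0.
have ua : u a = 0 by rewrite /u !subrr sqnorm0 addr0.
have [c c0 ucv] : exists2 c, 0 <= c &
    forall x, [set x : 'rV[R]_n | sqnorm (x - a) = d ^+ 2] x -> 0 < u x + c * v x.
  apply: penalty; [exact: sphere_compact | exact: class_C_continuous uC |
    exact: class_C_continuous vC | exact: v_ge0 |].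
  move=> x /= xd /v_eq0 xS; rewrite /u xd ltr_wpDl ?exprn_gt0 // subr_ge0.
  exact: a_min.
pose w x := u x + c * v x.
have wC : class_C 1 w.
  apply: (class_C_add uC); apply: (class_C_mul _ vC); exact: class_C_cst.
have aball : [set x : 'rV[R]_n | sqnorm (x - a) <= d ^+ 2] a.
  by rewrite /= subrr sqnorm0 exprn_ge0 // ltW.
have [x /= xd xmin] := compact_min (@closed_ball_compact _ _ a (d ^+ 2))
  (ex_intro _ a aball) (class_C_continuous wC).
have {}xd : sqnorm (x - a) < d ^+ 2.
  rewrite lt_neqAle xd andbT; apply/eqP => /ucv; apply/negP; rewrite -leNgt.
  by have := xmin a aball; rewrite /w ua va mulr0 addr0.
exists x, (fun i => 2 * c * sqrtpow 2 (- g i x)), (fun j => - (2 * c * h j x)).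
split=> // [i|i gi|j].
- by rewrite mulr_ge0 ?sqrtpow_ge0 // mulr_ge0.
- by rewrite /sqrtpow ler0_sqrtr ?expr0n ?mulr0 // oppr_le0 ltW.
have xnear : \forall y \near x, w x <= w y.
  have : \forall y \near x, sqnorm (y - a) < d ^+ 2.
    exact: (cvgr_lt (sqnorm (x - a)) (@sqdist_continuous _ _ a x) _ xd).
  by apply: filterS => y yd; apply: xmin; exact: ltW.
have dg i : is_derive x (delta_mx 0 j) (fun y => sqrtpow 4 (- g i y))
    (4 / 2 * sqrtpow 2 (- g i x) * - partial j (g i) x).
  apply: is_derive_compR; first exact: is_derive_sqrtpow.
  by have := class_C_is_derive j x (gC i); exact: is_deriveN.
have dh i := is_derive_sqr (class_C_is_derive j x (hC i)).
have ds i : is_derive x (delta_mx 0 j) (fun y => (y - a) 0 i ^+ 2)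
    (2 * (x - a) 0 i * (j == i)%:R).
  apply: is_derive_sqr; under eq_fun do rewrite 2!mxE.
  rewrite -[X in is_derive _ _ _ X]subr0; apply: is_deriveB.
  exact: is_derive_coord.
have dw := is_deriveD (is_deriveD (is_deriveB (class_C_is_derive j x fC)
  (is_derive_cst (f a) x (delta_mx 0 j))) (is_derive_sumf ds))
  (is_deriveZ c (is_deriveD (is_derive_sumf dg) (is_derive_sumf dh))).
have dwy y : derivable w y (delta_mx 0 j) by case: wC => _ /(_ j) [].
have := partial_at_min dw dwy xnear.
rewrite subr0 (bigD1 j) //= eqxx mulr1 big1 ?addr0; last first.
  by move=> i ij; rewrite eq_sym (negbTE ij) mulr0.
rewrite !mxE => /eqP; rewrite addr_eq0 => /eqP ->.
rewrite /GRing.scale /= mulrDr opprD !mulr_sumr -!sumrN.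
by congr (_ + _); apply: eq_bigr => i _; field.
Qed.

(** The defect [Psi] in the Fritz John conditions is minimized over the unit
    sphere of multipliers. Its minimum is zero, since the normalized multipliers
    of [approximate_KKT] make it arbitrarily small; regularity then shows that
    the multiplier [mu0] of [f] is not zero, and one divides by it. *)
Lemma KKT_exists : regular_at g h a ->
  exists lambda nu, KKT_multipliers f g h a lambda nu.
Proof.
move=> reg.
pose mu0 (u : 'rV[R]_(1 + (l + m))) := u 0 (lshift _ 0).
pose la (u : 'rV[R]_(1 + (l + m))) i := u 0 (rshift 1 (lshift m i)).
pose nu (u : 'rV[R]_(1 + (l + m))) i := u 0 (rshift 1 (rshift l i)).
pose res x (u : 'rV[R]_(1 + (l + m))) j := mu0 u * partial j f x -
  \sum_(i : 'I_l) la u i * partial j (g i) x -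
  \sum_(i : 'I_m) nu u i * partial j (h i) x.
pose Psi u := \sum_j res a u j ^+ 2 + \sum_i sqrtpow 4 (- la u i) +
  sqrtpow 4 (- mu0 u) + \sum_i (g i a * la u i) ^+ 2.
pose K := [set u : 'rV[R]_(1 + (l + m)) | sqnorm (u - 0) = 1].
have Psi_cont : continuous Psi.
  apply: (@class_C_continuous _ _ 0).
  have coordC i : class_C 0 (fun u : 'rV[R]_(1 + (l + m)) => u 0 i).
    exact: class_C_coord.
  have cst_mul (c : R) i : class_C 0 (fun u : 'rV[R]_(1 + (l + m)) => c * u 0 i).
    by apply: class_C_mul => //; exact: class_C_cst.
  have mul_cst (c : R) i : class_C 0 (fun u : 'rV[R]_(1 + (l + m)) => u 0 i * c).
    by apply: class_C_mul => //; exact: class_C_cst.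
  have opp_pow i : class_C 0 (fun u : 'rV[R]_(1 + (l + m)) => sqrtpow 4 (- u 0 i)).
    by apply: class_C_sqrtpow => //; apply: class_C_opp; exact: coordC.
  apply: class_C_add; last first.
    by apply: class_C_sum => i; apply: class_C_exp; exact: cst_mul.
  apply: class_C_add; last exact: opp_pow.
  apply: class_C_add; last by apply: class_C_sum => i; exact: opp_pow.
  apply: class_C_sum => j; apply: class_C_exp; apply: class_C_sub.
    apply: class_C_sub; first exact: mul_cst.
    by apply: class_C_sum => i; exact: mul_cst.
  by apply: class_C_sum => i; exact: mul_cst.
have K0 : K !=set0.
  exists (delta_mx 0 0); rewrite /K /= subr0 /sqnorm (bigD1 0) //= big1 ?addr0.
    by rewrite mxE eqxx expr1n.
  by move=> i i0; rewrite mxE (negbTE i0) expr0n.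
have [u Ku umin] := compact_min (@sphere_compact _ _ 0 1) K0 Psi_cont.
have [P0|P0] := eqVneq (Psi u) 0.
  move/eqP: P0; rewrite /Psi.
  have sqrt_sum_ge0 i : 0 <= sqrtpow 4 (- la u i) by exact: sqrtpow_ge0.
  rewrite !paddr_eq0 ?addr_ge0 ?sqrtpow_ge0 ?sumr_ge0 //; try by
    move=> i _; exact: sqr_ge0.
  rewrite !psumr_eq0 //; try by move=> i _; exact: sqr_ge0.
  move=> /andP[/andP[/andP[/allP r0 /allP la0] mu00] /allP gla0].
  have {}r0 j : res a u j = 0.
    by have := r0 j; rewrite mem_index_enum sqrf_eq0 => /(_ isT)/eqP.
  have pow0 (t : R) : sqrtpow 4 (- t) == 0 -> 0 <= t.
    by move=> /eqP t0; rewrite leNgt -oppr_gt0 -(@sqrtpow_gt0 _ 4) // t0 ltxx.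
  have {}la0 i : 0 <= la u i.
    by apply: pow0; have := la0 i; rewrite mem_index_enum; exact.
  have {}mu00 : 0 <= mu0 u by exact: pow0.
  have {}gla0 i : g i a * la u i = 0.
    by have := gla0 i; rewrite mem_index_enum sqrf_eq0 => /(_ isT)/eqP.
  have gradE : mu0 u *: gradient f a - \sum_i la u i *: gradient (g i) a
      - \sum_j nu u j *: gradient (h j) a = 0.
    have gE (N : nat) (F : 'I_N -> 'rV[R]_n -> R) (c : 'I_N -> R) j :
        (\sum_i c i *: gradient (F i) a) 0 j = \sum_i c i * partial j (F i) a.
      by rewrite summxE; apply: eq_bigr => i _; rewrite !mxE.
    by apply/rowP => j; rewrite !mxE !gE -[RHS](r0 j).
  have [mu0E|mu0N] := eqVneq (mu0 u) 0.
    exfalso; move: gradE; rewrite mu0E scale0r sub0r -opprD => /eqP.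
    rewrite oppr_eq0 => /eqP/(regular_coef0 reg)[i gi|laE nuE].
      by apply/eqP; have /eqP := gla0 i; rewrite mulf_eq0 (negbTE gi).
    move: Ku; rewrite /K /= subr0 /sqnorm big_split_ord /= big_ord1.
    rewrite [X in X ^+ 2](mu0E : u 0 (lshift _ 0) = 0).
    rewrite big_split_ord /= !big1 ?addr0 => [|i _|i _]; last 2 first.
    - by rewrite (nuE i : u _ _ = 0) expr0n.
    - by rewrite (laE i : u _ _ = 0) expr0n.
    by rewrite expr0n => /eqP; rewrite eq_sym oner_eq0.
  exists (fun i => la u i / mu0 u), (fun j => nu u j / mu0 u); split=> [|i].
    apply: (scalerI mu0N); rewrite scaler0; apply: etrans gradE.
    rewrite !scalerBr !scaler_sumr.
    by congr (_ - _ - _); apply: eq_bigr => i _; rewrite scalerA mulrCA mulfV ?mulr1.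
  by rewrite divr_ge0 // mulrAC [_ * g i a]mulrC gla0 mul0r.
exfalso; have {}P0 : 0 < Psi u.
  rewrite lt_def P0 /= !addr_ge0 ?sqrtpow_ge0 ?sumr_ge0 // => i _;
    by [exact: sqr_ge0 | exact: sqrtpow_ge0].
(* [B x j] bounds the defect at [a] of normalized multipliers found at [x] *)
pose B x j := `|partial j f a - partial j f x - 2 * (x 0 j - a 0 j)| +
  \sum_i `|partial j (g i) a - partial j (g i) x| +
  \sum_i `|partial j (h i) a - partial j (h i) x|.
have absC (v : 'rV[R]_n -> R) : class_C 0 v -> class_C 0 (fun x => `|v x|).
  move=> vC; split=> // x.
  exact: (cvg_norm (class_C_continuous vC (x := x))).
have diffC F j : class_C 1 F -> class_C 0 (fun x => partial j F a - partial j F x).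
  move=> FC; apply: class_C_sub; first exact: class_C_cst.
  exact: class_C_partial.
have BC : class_C 0 (fun x => \sum_j B x j ^+ 2).
  apply: class_C_sum => j; apply: class_C_exp; apply: class_C_add.
    apply: class_C_add; last by apply: class_C_sum => i; exact/absC/diffC.
    apply/absC/class_C_sub; first exact: diffC.
    apply: class_C_mul; first exact: class_C_cst.
    by apply: class_C_sub; [exact: class_C_coord | exact: class_C_cst].
  by apply: class_C_sum => i; exact/absC/diffC.
have Ba : \sum_j B a j ^+ 2 = 0.
  rewrite big1 // => j _; rewrite /B !subrr mulr0 subr0 normr0 add0r.
  by rewrite !big1 ?addr0 ?expr0n // => i _; rewrite subrr normr0.
have B_cvg : (fun x => \sum_j B x j ^+ 2) @ a --> (0 : R).
  by have := class_C_continuous BC (x := a); rewrite /continuous_at Ba.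
have near_B : \forall x \near a, \sum_j B x j ^+ 2 < Psi u.
  exact: (cvgr_lt _ B_cvg _ P0).
have near_g : \forall x \near a, forall i, 0 < g i a -> 0 < g i x.
  apply: (@filter_forall _ 'I_l _ (nbhs a)) => i.
  have [gi|gi] := ltP 0 (g i a); last exact: nearW.
  have cg : g i x @[x --> a] --> g i a by exact: class_C_continuous (gC i) a.
  near=> x => _; near: x; exact: (cvgr_gt _ cg _ gi).
have near_Bg : \forall x \near a, \sum_j B x j ^+ 2 < Psi u /\
    forall i, 0 < g i a -> 0 < g i x.
  by near=> x; split; near: x.
have [d /= d0 Hd] := (nbhs_ballP _ _).1 near_Bg.
have [x [lam [nul [xd lam0 glam E]]]] := approximate_KKT d0.
have [xB xg] : \sum_j B x j ^+ 2 < Psi u /\ (forall i, 0 < g i a -> 0 < g i x).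
  apply: Hd; rewrite -ball_normE /= distrC [ltLHS]mx_normrE.
  apply/bigmax_ltP; split=> // -[r i] _ /=; rewrite (ord1 r).
  rewrite -(ltr_pXn2r (_ : 0 < 2)%N) ?nnegrE ?(ltW d0) // real_normK ?num_real //.
  exact: le_lt_trans (sqr_coord_le _ _) xd.
pose U : 'rV[R]_(1 + (l + m)) :=
  row_mx (const_mx 1) (row_mx (\row_i lam i) (\row_j nul j)).
have U0 : U != 0.
  apply/eqP => /rowP/(_ (lshift _ 0)); rewrite row_mxEl !mxE => /eqP.
  by rewrite oner_eq0.
pose s := Num.sqrt (sqnorm U).
have s0 : 0 < s by rewrite sqrtr_gt0 sqnorm_gt0.
have sE : s ^+ 2 = sqnorm U by rewrite sqr_sqrtr // sqnorm_ge0.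
pose u' := s^-1 *: U.
have Ku' : K u'.
  by rewrite /K /= subr0 sqnormZ -sE -exprMn mulVf ?expr1n // gt_eqF.
have mu0' : mu0 u' = s^-1 by rewrite /mu0 mxE row_mxEl mxE mulr1.
have la' i : la u' i = s^-1 * lam i by rewrite /la mxE row_mxEr row_mxEl mxE.
have nu' i : nu u' i = s^-1 * nul i by rewrite /nu mxE row_mxEr row_mxEr mxE.
have coord1 i : `|u' 0 i| <= 1.
  rewrite -(ler_pXn2r (_ : 0 < 2)%N) ?nnegrE // real_normK ?num_real // expr1n.
  by have := sqr_coord_le u' i; move: Ku'; rewrite /K /= subr0 => ->.
have mul_le c t i : c = u' 0 i -> `|c * t| <= `|t|.
  by move=> ->; rewrite normrM ler_piMl.
suff : Psi u' <= \sum_j B x j ^+ 2.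
  by have := umin u' Ku'; lra.
rewrite /Psi [X in _ + X]big1 ?addr0; last first.
  move=> i _; have := a_feasible.1 i; rewrite le_eqVlt => /orP[/eqP <-|/xg/glam gi].
    by rewrite mul0r expr0n.
  by rewrite la' gi !mulr0 expr0n.
have -> : sqrtpow 4 (- mu0 u') = 0.
  by rewrite mu0' /sqrtpow ler0_sqrtr ?expr0n // oppr_le0 invr_ge0 ltW.
rewrite addr0.
rewrite [X in _ + X]big1 ?addr0; last first.
  move=> i _; rewrite /sqrtpow ler0_sqrtr ?expr0n // oppr_le0 la'.
  by rewrite mulr_ge0 // invr_ge0 ltW.
apply: ler_sum => j _.
have -> : res a u' j = mu0 u' * (partial j f a - partial j f x - 2 * (x 0 j - a 0 j))
  - \sum_i la u' i * (partial j (g i) a - partial j (g i) x)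
  - \sum_i nu u' i * (partial j (h i) a - partial j (h i) x).
  have E' : s^-1 * (partial j f x + 2 * (x 0 j - a 0 j)) =
     \sum_i la u' i * partial j (g i) x + \sum_i nu u' i * partial j (h i) x.
    rewrite E mulrDr !mulr_sumr; congr (_ + _); apply: eq_bigr => i _.
      by rewrite la' mulrA.
    by rewrite nu' mulrA.
  under eq_bigr do rewrite mulrBr.
  under [X in _ = _ - X]eq_bigr do rewrite mulrBr.
  rewrite !sumrB /res mu0'; move: E'.
  set S1 := \sum_i _; set S2 := \sum_i _; set S3 := \sum_i _; set S4 := \sum_i _.
  by move=> E'; rewrite -[LHS]addr0 -(subrr (S1 + S2)) -{2}E'; ring.
have B0 : 0 <= B x j by rewrite !addr_ge0 // sumr_ge0.
rewrite -[leLHS]real_normK ?num_real // ler_pXn2r ?nnegrE //.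
apply: le_trans (ler_normB _ _) (lerD (le_trans (ler_normB _ _) (lerD _ _)) _).
- exact: mul_le.
- by apply: le_trans (ler_norm_sum _ _ _) (ler_sum _ _) => i _; exact: mul_le.
- by apply: le_trans (ler_norm_sum _ _ _) (ler_sum _ _) => i _; exact: mul_le.
Unshelve. all: by end_near. Qed.

End KKT.

(** * Certificates near a minimizer *)

Section SecondOrder.
Variables (R : realType) (D : o_minimal_structure R) (n : nat).
Implicit Types (u v : 'rV[R]_n -> R) (x y a : 'rV[R]_n).

Lemma def_class_leq k j u : (j <= k)%N -> def_class D k u -> def_class D j u.
Proof. by move=> jk [ud uC]; split => //; exact: class_C_leq uC. Qed.

Lemma hessianE u a i j : hessian u a i j = partial i (partial j u) a.
Proof. by rewrite mxE. Qed.

Lemma is_derive_linear_part (q : 'I_n -> 'rV[R]_n -> R) a j :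
  (forall i, class_C 1 (q i)) ->
  is_derive a (delta_mx 0 j) (fun x => \sum_i (x 0 i - a 0 i) * q i x) (q j a).
Proof.
move=> qC.
have dt i : is_derive a (delta_mx 0 j) (fun x => (x 0 i - a 0 i) * q i x)
   ((a 0 i - a 0 i) * partial j (q i) a + q i a * ((j == i)%:R - 0)).
  apply: is_deriveM; last exact: class_C_is_derive (qC i).
  by apply: is_deriveB; exact: is_derive_coord.
apply: is_derive_eq (is_derive_sumf dt) _.
rewrite (bigD1 j) //= eqxx subrr mul0r add0r subr0 mulr1 big1 ?addr0 // => i ij.
by rewrite subrr mul0r eq_sym (negbTE ij) subr0 mulr0 addr0.
Qed.

(** Hadamard's lemma is used for [u], then for the coefficients, which vanish at
    [a] since [a] is critical. The Hessian is then read off by the product rule.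
    *)
Lemma hadamard2 k u a : (0 < k)%N -> def_class D k.+2 u -> u a = 0 ->
  (forall j, partial j u a = 0) ->
  exists q : 'I_n -> 'I_n -> 'rV[R]_n -> R,
  [/\ forall i j, def_class D k (q i j),
      forall x, u x = \sum_i \sum_j q i j x * ((x 0 i - a 0 i) * (x 0 j - a 0 j)) &
      forall i j, hessian u a i j = q i j a + q j i a].
Proof.
move=> k0 [ud uC] ua du; have [q qP uE] := hadamard uC ud ua.
have q1C i : class_C 1 (q i) by apply: class_C_leq (qP i).1.
have partial_lin v (r : 'I_n -> 'rV[R]_n -> R) : (forall i, class_C 1 (r i)) ->
    (forall x, v x = \sum_i (x 0 i - a 0 i) * r i x) -> forall j, partial j v a = r j a.
  move=> rC /funext -> j; apply: derive_val; exact: is_derive_linear_part.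
have qa j : q j a = 0 by rewrite -(partial_lin u q).
have /choice[q2 q2P] : forall i, exists r : 'I_n -> 'rV[R]_n -> R,
    (forall j, class_C k (r j) /\ definable_fun D (r j)) /\
    (forall x, q i x = \sum_j (x 0 j - a 0 j) * r j x).
  by move=> i; have [r rP rE] := hadamard (qP i).1 (qP i).2 (qa i); exists r.
have dq i j : partial j (q i) a = q2 i j a.
  apply: partial_lin (q2P i).2 j => j.
  by apply: class_C_leq (proj1 ((q2P i).1 j)).
exists q2; split=> [i j|x|i j].
- by have [? ?] := (q2P i).1 j.
- rewrite uE; apply: eq_bigr => i _; rewrite (q2P i).2 mulr_sumr.
  by apply: eq_bigr => j _; ring.
rewrite mxE.
have -> : partial j u = fun x => q j x + \sum_i' (x 0 i' - a 0 i') * partial j (q i') x.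
  apply: partialE => x; rewrite (funext uE).
  have dt i' : is_derive x (delta_mx 0 j) (fun x => (x 0 i' - a 0 i') * q i' x)
     ((x 0 i' - a 0 i') * partial j (q i') x + q i' x * ((j == i')%:R - 0)).
    apply: is_deriveM; last exact: class_C_is_derive (q1C i').
    by apply: is_deriveB; exact: is_derive_coord.
  apply: is_derive_eq (is_derive_sumf dt) _; rewrite big_split /= addrC; congr (_ + _).
  rewrite (bigD1 j) //= eqxx subr0 mulr1 big1 ?addr0 // => i' ij.
  by rewrite eq_sym (negbTE ij) subr0 mulr0.
rewrite -dq addrC -dq; apply: derive_val; apply: is_deriveD.
  exact: class_C_is_derive (q1C j).
apply: (@is_derive_linear_part (fun i' => partial j (q i'))) => i'.
by apply: class_C_partial; apply: class_C_leq (qP i').1.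
Qed.

End SecondOrder.

Section Quadratic.
Variables (R : realType) (n : nat).

(** A small perturbation of a positive multiple of the squared norm is a sum of
    squares with positive weights: the diagonal terms absorb the products [y i *
    y j] by polarization. *)
Lemma quadratic_perturbation (eps : R) (e : 'I_n -> 'I_n -> R) (y : 'I_n -> R) :
  \sum_i \sum_j e i j * (y i * y j) + n%:R * eps * \sum_i y i ^+ 2 =
  \sum_i \sum_j ((eps + e i j) * ((y i + y j) / 2) ^+ 2 +
                 (eps - e i j) * ((y i - y j) / 2) ^+ 2).
Proof.
have -> : n%:R * eps * \sum_i y i ^+ 2 =
    \sum_i \sum_j (eps / 2 * y i ^+ 2 + eps / 2 * y j ^+ 2).
  under [RHS]eq_bigr do rewrite big_split /= sumr_const card_ord.
  rewrite [RHS]big_split /= [X in _ = _ + X]exchange_big /=.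
  under [X in _ = _ + X]eq_bigr do rewrite sumr_const card_ord.
  rewrite -[RHS]big_split /= mulr_sumr; apply: eq_bigr => i _.
  by rewrite -mulrnDl -mulr_natl; field.
rewrite -big_split; apply: eq_bigr => i _; rewrite -big_split.
by apply: eq_bigr => j _ /=; field.
Qed.

Lemma quadratic_sub_diag (A : 'I_n -> 'I_n -> R) (t : R) (y : 'I_n -> R) :
  \sum_i \sum_j (A i j - (i == j)%:R * t) * (y i * y j) =
  \sum_i \sum_j A i j * (y i * y j) - t * \sum_i y i ^+ 2.
Proof.
rewrite mulr_sumr -sumrB; apply: eq_bigr => i _.
under eq_bigr do rewrite mulrBl; rewrite sumrB; congr (_ - _).
rewrite (bigD1 i) //= eqxx mul1r big1 ?addr0 // => j ij.
by rewrite eq_sym (negbTE ij) !mul0r.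
Qed.

Lemma sum_sqr_form N (r : 'I_N -> 'I_n -> R) (y : 'I_n -> R) :
  \sum_s (\sum_j y j * r s j) ^+ 2 =
  \sum_i \sum_j (\sum_s r s i * r s j) * (y i * y j).
Proof.
have prod_form s : (\sum_j y j * r s j) ^+ 2 =
    \sum_i \sum_j r s i * r s j * (y i * y j).
  rewrite expr2 mulr_suml; apply: eq_bigr => i _; rewrite mulr_sumr.
  by apply: eq_bigr => j _; ring.
under eq_bigr do rewrite prod_form.
rewrite exchange_big; apply: eq_bigr => i _; rewrite exchange_big.
by apply: eq_bigr => j _; rewrite mulr_suml.
Qed.

Lemma dotE (u v : 'rV[R]_n) : dot u v = \sum_i u 0 i * v 0 i.
Proof. by rewrite /dot mxE; apply: eq_bigr => i _; rewrite mxE. Qed.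

Lemma quadratic_formE (A : 'M[R]_n) (v : 'rV[R]_n) :
  (v *m A *m v^T) 0 0 = \sum_i \sum_j A i j * (v 0 i * v 0 j).
Proof.
rewrite mxE; under eq_bigr do rewrite !mxE mulr_suml.
rewrite exchange_big; apply: eq_bigr => i _; apply: eq_bigr => j _; ring.
Qed.

End Quadratic.

Section LocalCertificate.
Variables (R : realType) (D : o_minimal_structure R) (n l m k : nat).
Variables (f : 'rV[R]_n -> R) (g : 'I_l -> 'rV[R]_n -> R) (h : 'I_m -> 'rV[R]_n -> R).
Hypotheses (k_gt0 : (0 < k)%N) (fC : def_class D k.+2 f)
  (gC : forall i, def_class D k.+2 (g i)) (hC : forall j, def_class D k.+2 (h j)).
Variable a : 'rV[R]_n.
Hypothesis a_min : minimizer f g h a.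

Let fstar := opt_value f g h.
Let F x := f x - fstar.

(** The identity for [F] behind the local certificate, valid on the whole space
    but of use only near [a], where the weights [w t] and [om i] are positive.
    It comes from the Lagrangian [L] and from adding and subtracting [c] times
    the squares of the active constraints, which makes the quadratic form of [L]
    definite at [a] and replaces the multiplier [lambda i] by [lambda i - c * g
    i]; strict complementarity makes the latter positive at [a]. *)
Lemma weighted_certificate lambda nu :
  KKT_multipliers f g h a lambda nu -> (forall i, 0 < lambda i + g i a) ->
  second_order_sufficiency f g h a ->
  exists kappa (T : finType) s0 (w q : T -> 'rV[R]_n -> R)
    (om : 'I_l -> 'rV[R]_n -> R) (psi : 'I_m -> 'rV[R]_n -> R),
  [/\ 0 < kappa, sum_of_squares D k s0,
     (forall t, def_class D k (w t) /\ 0 < w t a) /\ (forall t, def_class D k (q t)),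
     (forall i, def_class D k (om i) /\ 0 < om i a) /\ (forall j, def_class D k (psi j)) &
     forall x, F x = kappa * sqnorm (x - a) + s0 x + \sum_t w t x * q t x ^+ 2 +
       \sum_(i in active g a) om i x * g i x + \sum_j psi j x * h j x].
Proof.
move=> kkt sc soc.
have [[ga ha] fa] := a_min.
have [gradE comp] := kkt.
have ltk : (k <= k.+2)%N by rewrite leqW.
have lam0 i : i \notin active g a -> lambda i = 0.
  rewrite inE => gi; have /eqP := (comp i).1.
  by rewrite mulf_eq0 (negbTE gi) orbF => /eqP.
have lam_gt0 i : i \in active g a -> 0 < lambda i.
  by rewrite inE => /eqP gi; have := sc i; rewrite gi addr0.
have [L LE sosL] : exists2 L : 'rV[R]_n -> R,
    forall y, L y = f y - \sum_i lambda i * g i y - \sum_j nu j * h j y &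
    forall v, tangent_space g h a v -> v != 0 ->
      0 < (v *m hessian L a *m v^T) 0 0.
  exists (fun y => f y - \sum_(i in active g a) lambda i * g i y -
    \sum_j nu j * h j y) => [y|]; last exact: soc lambda nu kkt.
  congr (_ - _ - _); rewrite [RHS](bigID (mem (active g a))) /=.
  by rewrite [X in _ = _ + X]big1 ?addr0 // => i /lam0 ->; rewrite mul0r.
have [u uLE] : exists u : 'rV[R]_n -> R, forall y, u y = L y - fstar by eexists.
have scale_class c j v : def_class D j v -> def_class D j (fun y : 'rV[R]_n => c * v y).
  by move=> vC; apply: def_class_mul => //; exact: def_class_cst.
have LC : def_class D k.+2 L.
  rewrite (funext LE).
  have gS : def_class D k.+2 (fun y => \sum_i lambda i * g i y).
    by apply: def_class_sum => i; exact: scale_class (gC i).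
  have hS : def_class D k.+2 (fun y => \sum_j nu j * h j y).
    by apply: def_class_sum => i; exact: scale_class (hC i).
  exact: (def_class_sub (def_class_sub fC gS) hS).
have uC : def_class D k.+2 u.
  by rewrite (funext uLE); exact: def_class_sub LC (def_class_cst D n k.+2 fstar).
have ua : u a = 0.
  rewrite uLE LE fa !big1 ?subr0 ?subrr // => i _; first by rewrite ha mulr0.
  exact: (comp i).1.
have duE j : partial j u = partial j L.
  rewrite (funext uLE); apply: partialE => x.
  rewrite -[X in is_derive _ _ _ X]subr0.
  exact: (is_deriveB (class_C_is_derive j x LC.2) (is_derive_cst fstar x _)).
have du j : partial j u a = 0.
  rewrite duE (funext LE).
  have dg i := is_deriveZ (lambda i) (class_C_is_derive j a (gC i).2).
  have dh i := is_deriveZ (nu i) (class_C_is_derive j a (hC i).2).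
  have dL := is_deriveB (is_deriveB (class_C_is_derive j a fC.2)
    (is_derive_sumf dg)) (is_derive_sumf dh).
  rewrite [LHS](@derive_val _ _ _ _ _ _ _ dL).
  move/rowP: gradE => /(_ j); rewrite !mxE !summxE => E; apply: etrans E.
  by congr (_ - _ - _); apply: eq_bigr => i _; rewrite !mxE.
have [q [qC uE hessE]] := hadamard2 k_gt0 uC ua du.
have {}hessE i j : hessian L a i j = q i j a + q j i a.
  have Eu := hessianE u a i j; rewrite duE -hessianE in Eu.
  exact: etrans (esym Eu) (hessE i j).
(* [b i * g i] vanishes at [a] for every [i], not only for the active ones *)
pose b i : R := (i \in active g a)%:R.
have /choice[G GP] : forall i, exists r : 'I_n -> 'rV[R]_n -> R,
   (forall j, class_C k.+1 (r j) /\ definable_fun D (r j)) /\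
   (forall x, b i * g i x = \sum_j (x 0 j - a 0 j) * r j x).
  move=> i; have [gbd gbC] := scale_class (b i) _ _ (gC i).
  have [|r rP rE] := hadamard (a := a) gbC gbd; last by exists r.
  rewrite /b inE; case: eqP => [->|_]; first by rewrite mulr0.
  by rewrite mul0r.
have /choice[H HP] : forall i, exists r : 'I_n -> 'rV[R]_n -> R,
   (forall j, class_C k.+1 (r j) /\ definable_fun D (r j)) /\
   (forall x, h i x = \sum_j (x 0 j - a 0 j) * r j x).
  by move=> i; have [r rP rE] := hadamard (hC i).2 (hC i).1 (ha i); exists r.
have Ga i j : G i j a = b i * partial j (g i) a.
  have := is_derive_linear_part (q := G i) a j
    (fun i' => class_C_leq (ltn0Sn k) ((GP i).1 i').1).
  rewrite -(funext (GP i).2) => dG; rewrite -(@derive_val _ _ _ _ _ _ _ dG).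
  apply: derive_val; exact: (is_deriveZ (b i) (class_C_is_derive j a (gC i).2)).
have Ha i j : H i j a = partial j (h i) a.
  have := is_derive_linear_part (q := H i) a j
    (fun i' => class_C_leq (ltn0Sn k) ((HP i).1 i').1).
  by rewrite -(funext (HP i).2) => dH; rewrite -(@derive_val _ _ _ _ _ _ _ dH).
(* The forms at [a] of [L] and of the penalty: [p0] vanishes exactly on the
   tangent space. *)
pose q0 (v : 'rV[R]_n) := \sum_i \sum_j q i j a * (v 0 i * v 0 j).
pose p0 (v : 'rV[R]_n) := \sum_s (\sum_j v 0 j * G s j a) ^+ 2 +
  \sum_s (\sum_j v 0 j * H s j a) ^+ 2.
have contC (v : 'rV[R]_n -> R) : class_C 0 v -> continuous v.
  exact: class_C_continuous.
have linC (c : 'I_n -> R) : class_C 0 (fun v : 'rV[R]_n => \sum_j v 0 j * c j).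
  apply: class_C_sum => j; apply: class_C_mul; first exact: class_C_coord.
  exact: class_C_cst.
have [c [kappa [kappa0 cP]]] :
    exists c kappa, 0 < kappa /\ forall v, kappa * sqnorm v <= q0 v + c * p0 v.
  apply: finsler.
  - apply: contC; apply: class_C_sum => i; apply: class_C_sum => j.
    apply: class_C_mul; first exact: class_C_cst.
    by apply: class_C_mul; exact: class_C_coord.
  - by apply: contC; apply: class_C_add; apply: class_C_sum => s;
      apply: class_C_exp; exact: linC.
  - move=> t v; rewrite /q0 mulr_sumr; apply: eq_bigr => i _; rewrite mulr_sumr.
    by apply: eq_bigr => j _; rewrite !mxE; ring.
  - have linZ t (v : 'rV[R]_n) (r : 'I_n -> R) :
        (\sum_j (t *: v) 0 j * r j) ^+ 2 = t ^+ 2 * (\sum_j v 0 j * r j) ^+ 2.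
      rewrite -exprMn mulr_sumr; congr (_ ^+ 2); apply: eq_bigr => j _.
      by rewrite mxE mulrA.
    move=> t v; rewrite /p0 mulrDr !mulr_sumr.
    by congr (_ + _); apply: eq_bigr => s _; exact: linZ.
  - by move=> v; rewrite addr_ge0 // sumr_ge0 // => s _; exact: sqr_ge0.
  - move=> v v0 /eqP; rewrite /p0 paddr_eq0 ?sumr_ge0 //; try by
      move=> s _; exact: sqr_ge0.
    rewrite !psumr_eq0; try by move=> s _; exact: sqr_ge0.
    move=> /andP[/allP vG /allP vH].
    have tv : tangent_space g h a v.
      split=> [s sa|s].
        have := vG s; rewrite mem_index_enum sqrf_eq0 => /(_ isT)/eqP E.
        rewrite dotE; apply: etrans E; apply: eq_bigr => j _.
        by rewrite Ga /b sa mul1r mxE.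
      have := vH s; rewrite mem_index_enum sqrf_eq0 => /(_ isT)/eqP E.
      by rewrite dotE; apply: etrans E; apply: eq_bigr => j _; rewrite Ha mxE.
    have := sosL v tv v0; rewrite quadratic_formE.
    have q0T : q0 v = \sum_i \sum_j q j i a * (v 0 i * v 0 j).
      rewrite /q0 exchange_big; apply: eq_bigr => i _; apply: eq_bigr => j _.
      by rewrite [v 0 j * _]mulrC.
    have -> : \sum_i \sum_j hessian L a i j * (v 0 i * v 0 j) = q0 v + q0 v.
      rewrite {2}q0T /q0 -big_split; apply: eq_bigr => i _.
      by rewrite -big_split; apply: eq_bigr => j _; rewrite hessE mulrDl.
    by lra.
pose Q i j x := q i j x + c * (\sum_s G s i x * G s j x + \sum_s H s i x * H s j x).
have QC i j : def_class D k (Q i j).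
  have lowG s j' : def_class D k (G s j').
    by apply: def_class_leq (leqnSn k) _; have [] := (GP s).1 j'.
  have lowH s j' : def_class D k (H s j').
    by apply: def_class_leq (leqnSn k) _; have [] := (HP s).1 j'.
  apply: def_class_add => //; apply: scale_class; apply: def_class_add;
    by apply: def_class_sum => s; exact: def_class_mul.
have QE x (y : 'I_n -> R) : \sum_i \sum_j Q i j x * (y i * y j) =
   \sum_i \sum_j q i j x * (y i * y j) +
   c * (\sum_s (\sum_j y j * G s j x) ^+ 2 + \sum_s (\sum_j y j * H s j x) ^+ 2).
  rewrite (sum_sqr_form (fun s j => G s j x)) (sum_sqr_form (fun s j => H s j x)).
  rewrite -big_split mulr_sumr -big_split; apply: eq_bigr => i _ /=.
  rewrite -big_split mulr_sumr -big_split; apply: eq_bigr => j _ /=.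
  by rewrite /Q; ring.
(* half of the margin [kappa] is kept for the perturbation [e] *)
have [N [Lr LrE]] : exists (N : nat) (Lr : 'I_N -> 'I_n -> R), forall y : 'I_n -> R,
    \sum_i \sum_j (Q i j a - (i == j)%:R * (kappa / 2)) * (y i * y j) =
    \sum_r (\sum_i Lr r i * y i) ^+ 2.
  apply: cholesky => y [i0 yi0]; pose v : 'rV[R]_n := \row_i y i.
  have v0 : v != 0 by apply: contraNneq yi0 => /rowP/(_ i0); rewrite !mxE => ->.
  rewrite quadratic_sub_diag QE subr_gt0.
  have yE : \sum_i y i ^+ 2 = sqnorm v by apply: eq_bigr => i _; rewrite mxE.
  have -> : \sum_i \sum_j q i j a * (y i * y j) = q0 v.
    by apply: eq_bigr => i _; apply: eq_bigr => j _; rewrite !mxE.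
  have -> : \sum_s (\sum_j y j * G s j a) ^+ 2 + \sum_s (\sum_j y j * H s j a) ^+ 2 = p0 v.
    by congr (_ + _); apply: eq_bigr => s _; congr (_ ^+ 2);
      apply: eq_bigr => j _; rewrite mxE.
  rewrite yE; apply: lt_le_trans (cP v).
  by rewrite ltr_pM2r ?sqnorm_gt0 //; lra.
(* [n.+1] instead of [n] avoids a division by zero *)
pose eps := kappa / (4 * n.+1%:R).
have eps0 : 0 < eps by rewrite divr_gt0 // mulr_gt0 // ltr0n.
have neps : n%:R * eps <= kappa / 4.
  have : n.+1%:R * eps = kappa / 4.
    have : (n.+1%:R : R) != 0 by rewrite pnatr_eq0.
    by rewrite /eps; move: (n.+1%:R) => N0 N0N; field.
  by rewrite -natr1 mulrDl mul1r; lra.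
pose e i j x := Q i j x - Q i j a.
have eC i j : def_class D k (e i j).
  by apply: def_class_sub => //; exact: def_class_cst.
have yC j (i : 'I_n) : def_class D j (fun x : 'rV[R]_n => x 0 i - a 0 i).
  by apply: def_class_sub; [exact: def_class_coord | exact: def_class_cst].
pose w (t : 'I_n * 'I_n * bool) x := if t.2 then eps + e t.1.1 t.1.2 x
  else eps - e t.1.1 t.1.2 x.
pose r (t : 'I_n * 'I_n * bool) (x : 'rV[R]_n) :=
  (if t.2 then (x 0 t.1.1 - a 0 t.1.1) + (x 0 t.1.2 - a 0 t.1.2)
   else (x 0 t.1.1 - a 0 t.1.1) - (x 0 t.1.2 - a 0 t.1.2)) / 2.
pose om i x := if i \in active g a then lambda i - c * g i x else 1.
have gk i : def_class D k (g i) := def_class_leq ltk (gC i).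
have hk i : def_class D k (h i) := def_class_leq ltk (hC i).
exists (kappa / 2 - n%:R * eps), [the finType of ('I_n * 'I_n * bool)%type],
  (fun x => \sum_s (\sum_i Lr s i * (x 0 i - a 0 i)) ^+ 2), w, r, om,
  (fun j x => nu j - c * h j x).
split.
- lra.
- apply: sos_sum => s; apply: sos_sqr; apply: def_class_sum => i.
  exact: scale_class.
- split=> [[[i j] []]|[[i j] []]]; rewrite /w /r /=.
  + by split; [apply: def_class_add => //; exact: def_class_cst
              | rewrite /e subrr addr0].
  + by split; [apply: def_class_sub => //; exact: def_class_cst
              | rewrite /e subrr subr0].
  + by apply: def_class_mul; [exact: def_class_add | exact: def_class_cst].
  + by apply: def_class_mul; [exact: def_class_sub | exact: def_class_cst].
- split=> [i|j]; last by apply: def_class_sub; [exact: def_class_cst | exact: scale_class].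
  rewrite /om; case: ifP => [ia|_]; last by split => //; exact: def_class_cst.
  split; first by apply: def_class_sub; [exact: def_class_cst | exact: scale_class].
  by move: (ia); rewrite inE => /eqP ->; rewrite mulr0 subr0 lam_gt0.
move=> x; pose y i := x 0 i - a 0 i.
have yE : sqnorm (x - a) = \sum_i y i ^+ 2.
  by apply: eq_bigr => i _; rewrite !mxE.
have wE : \sum_t w t x * r t x ^+ 2 = \sum_i \sum_j e i j x * (y i * y j) +
    n%:R * eps * \sum_i y i ^+ 2.
  rewrite quadratic_perturbation.
  rewrite -(pair_bigA _ (fun p b => w (p, b) x * r (p, b) x ^+ 2)) /=.
  under eq_bigr do rewrite big_bool.
  by rewrite -(pair_bigA _ (fun i j => w (i, j, true) x * r (i, j, true) x ^+ 2 +
     w (i, j, false) x * r (i, j, false) x ^+ 2)).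
have ugE : F x = u x + \sum_i lambda i * g i x + \sum_j nu j * h j x.
  by rewrite /F uLE LE; ring.
have form : u x = kappa / 2 * sqnorm (x - a) + \sum_s (\sum_i Lr s i * y i) ^+ 2 +
    \sum_i \sum_j e i j x * (y i * y j) -
    c * (\sum_s (b s * g s x) ^+ 2 + \sum_s h s x ^+ 2).
  under [X in _ - c * (X + _)]eq_bigr do rewrite (GP _).2.
  under [X in _ - c * (_ + X)]eq_bigr do rewrite (HP _).2.
  rewrite -LrE quadratic_sub_diag yE uE.
  have -> : \sum_i \sum_j e i j x * (y i * y j) =
     \sum_i \sum_j Q i j x * (y i * y j) - \sum_i \sum_j Q i j a * (y i * y j).
    rewrite -sumrB; apply: eq_bigr => i _; rewrite -sumrB.
    by apply: eq_bigr => j _; rewrite -mulrBl.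
  rewrite (QE x); ring.
have omE : \sum_(i in active g a) om i x * g i x = \sum_i lambda i * g i x -
    c * \sum_i (b i * g i x) ^+ 2.
  rewrite big_mkcond /= mulr_sumr -sumrB; apply: eq_bigr => i _.
  rewrite /om /b; case: (boolP (i \in active g a)) => [ia|ia] /=; first by ring.
  by rewrite lam0 // !mul0r expr0n mulr0 subr0.
have psiE : \sum_j (nu j - c * h j x) * h j x = \sum_j nu j * h j x -
    c * \sum_j h j x ^+ 2.
  by rewrite mulr_sumr -sumrB; apply: eq_bigr => j _; ring.
rewrite ugE form omE psiE wE -yE; ring.
Qed.

Let J := k.*2.+1.

(** Multiplication by high powers of the positive parts of all the weights turns
    each weight into a square: this replaces cut-off functions. Near [a] all the
    weights are positive, and [F] is then at least [kappa * sqnorm (x - a)] on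
    the feasible set. *)
Lemma local_certificate : has_lbound [set f x | x in feasible g h] ->
   regular_at g h a -> strict_complementarity f g h a ->
  second_order_sufficiency f g h a ->
  (exists chi, [/\ sum_of_squares D k chi, certified D k F g h chi & 0 < chi a]) /\
  (\forall x \near a, feasible g h x -> x != a -> F x != 0).
Proof.
move=> f_lb reg sc soc.
have low v : def_class D k.+2 v -> def_class D k v.
  by apply: def_class_leq; rewrite leqW.
have [[ga ha] fa] := a_min.
have [lambda [nu kkt]] : exists lambda nu, KKT_multipliers f g h a lambda nu.
  apply: KKT_exists => //; first exact: class_C_leq fC.2.
  - by move=> i; exact: class_C_leq (gC i).2.
  - by move=> j; exact: class_C_leq (hC j).2.
  - by move=> x xS; rewrite fa; apply: ge_inf => //; exists x.
have [kappa [T [s0 [w [q [om [psi [kappa0 s0P [wP qP] [omP psiP] E]]]]]]]] :=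
  weighted_certificate kkt (sc _ _ kkt) soc.
pose W (t : T + 'I_l) := match t with inl t => w t | inr i => om i end.
have WP t : def_class D k (W t) /\ 0 < W t a.
  by case: t => t; [exact: wP | exact: omP].
have powP t j : (k.*2 < j)%N -> sum_of_squares D k (fun x => sqrtpow j (W t x) ^+ 2).
  by move=> kj; apply/sos_sqr/def_class_sqrtpow => //; exact: (WP t).1.
pose chi x := \prod_t sqrtpow J (W t x) ^+ 2.
have chi_sos : sum_of_squares D k chi.
  by apply: sos_prod => t; exact: powP.
have chiW t : sum_of_squares D k (fun x => chi x * W t x).
  apply: (@sos_ext _ _ _ _ (fun x => sqrtpow J.+1 (W t x) ^+ 2 *
     \prod_(t' | t' != t) sqrtpow J (W t' x) ^+ 2)) => [x|].
    rewrite /chi [in RHS](bigD1 t) //= [RHS]mulrAC; congr (_ * _).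
    rewrite [RHS]mulrC [in RHS]expr2 mulrA sqrtpow_mul // /sqrtpow expr2 -!exprD.
    by congr (_ ^+ _); rewrite !addSn !addnS.
  by apply: sos_mul; [apply: powP; rewrite ltnS | apply: sos_prod => t'; exact: powP].
split.
  exists chi; split=> //; last first.
    by apply: prodr_gt0 => t _; rewrite exprn_gt0 // sqrtpow_gt0 // (WP t).2.
  exists (fun x => chi x * (kappa * sqnorm (x - a) + s0 x) +
      \sum_t (chi x * w t x) * q t x ^+ 2),
    (fun i x => if i \in active g a then chi x * om i x else 0),
    (fun j x => chi x * psi j x).
  split=> [|i|j|x].
  - apply: sos_add; last first.
      by apply: sos_sum => t; apply: sos_mul; [exact: (chiW (inl t)) | exact: sos_sqr].
    apply: sos_mul => //; apply: sos_add => //; apply: sos_mul.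
      by apply: sos_cst; exact: ltW.
    apply: (@sos_ext _ _ _ _ (fun x => \sum_i (x 0 i - a 0 i) ^+ 2)) => [x|].
      by apply: eq_bigr => i _; rewrite !mxE.
    apply: sos_sum => i; apply: sos_sqr.
    by apply: def_class_add; [exact: def_class_coord | exact: def_class_cst].
  - by case: (i \in active g a); [exact: (chiW (inr i)) | exact: sos_cst].
  - exact: (def_class_mul (sos_def_class chi_sos) (psiP j)).
  rewrite E /= !mulrDr !mulr_sumr.
  have -> : \sum_i (if i \in active g a then chi x * om i x else 0) * g i x =
     \sum_(i in active g a) chi x * (om i x * g i x).
    rewrite [RHS]big_mkcond; apply: eq_bigr => i _.
    by case: ifP => _; rewrite ?mul0r ?mulrA.
  congr (_ + _ + _ + _); last by apply: eq_bigr => j _; rewrite mulrA.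
  by apply: eq_bigr => t _; rewrite mulrA.
have nearW : \forall x \near a, forall t, 0 < W t x.
  apply: (@filter_forall _ _ _ (nbhs a)) => t.
  have cW := class_C_continuous (WP t).1.2 (x := a).
  exact: (cvgr_gt _ cW _ (WP t).2).
near=> x => -[gx hx] xa.
have W0 : forall t, 0 < W t x by near: x.
rewrite gt_eqF // E [X in _ + X]big1 ?addr0; last by move=> j _; rewrite hx mulr0.
have : 0 < kappa * sqnorm (x - a) by rewrite mulr_gt0 // sqnorm_gt0 // subr_eq0.
have := sos_ge0 x s0P.
have : 0 <= \sum_t w t x * q t x ^+ 2.
  by apply: sumr_ge0 => t _; rewrite mulr_ge0 ?sqr_ge0 // ltW // (W0 (inl t)).
have : 0 <= \sum_(i in active g a) om i x * g i x.
  by apply: sumr_ge0 => i _; rewrite mulr_ge0 // ltW // (W0 (inr i)).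
lra.
Unshelve. all: by end_near. Qed.

End LocalCertificate.

(** * Discrete definable sets *)

Section Finiteness.
Variables (R : realType) (D : o_minimal_structure R) (n : nat).

Lemma compact_discrete_finite (K : set 'rV[R]_n) : compact K ->
  (forall a, K a -> \forall x \near a, K x -> x = a) -> finite_set K.
Proof.
rewrite compact_cover => cK isoK.
have [|x Kx|A AK KA] := cK _ K (fun a => interior [set x | K x -> x = a]).
- by move=> a _; exact: open_interior.
- by exists x => //; exact: isoK.
have finA := finite_fset A; apply: sub_finite_set finA.
move=> x Kx; have [a aA /interior_subset/(_ Kx) ->] := KA x Kx; exact: aA.
Qed.

Lemma closed_discrete_countable (M : set 'rV[R]_n) : closed M ->
  (forall a, M a -> \forall x \near a, M x -> x = a) -> countable M.
Proof.
move=> cM isoM.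
pose B (N : nat) : set 'rV[R]_n := M `&` [set x | sqnorm (x - 0) <= N%:R].
have cB N : countable (B N).
  apply: finite_set_countable; apply: compact_discrete_finite.
    rewrite /B setIC; apply: compact_closedI => //; exact: closed_ball_compact.
  by move=> a [Ma _]; have := isoM a Ma; apply: filterS => x Mx [/Mx].
apply: (@sub_countable _ _ _ (\bigcup_N B N)); last exact: bigcup_countable.
apply: subset_card_le => x Mx.
exists (Num.truncn (sqnorm x)).+1 => //; split=> //=.
by rewrite subr0 ltW // truncnS_gt.
Qed.

Lemma countable_interval_finite (J : interval R) :
  countable [set` J] -> finite_set [set` J].
Proof.
move=> cJ.
have [[x [y [xJ yJ xy]]]|noxy] :=
    pselect (exists x y, [/\ x \in J, y \in J & x < y]).
  exfalso; have sub : `[x, y]%classic `<=` [set` J].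
    move=> z; rewrite /= in_itv /= => /andP[xz zy].
    by apply: (interval_is_interval xJ yJ); rewrite xz zy.
  have := countable_lebesgue_measure0 (sub_countable (subset_card_le sub) cJ).
  rewrite lebesgue_measure_itv /= lte_fin xy -EFinD => /eqP.
  by rewrite eqe subr_eq0 gt_eqF.
have [[x xJ]|J0] := pselect (exists x, x \in J).
  apply: (sub_finite_set _ (finite_set1 x)) => y yJ /=.
  apply: contrapT => /eqP; rewrite neq_lt => /orP[yx|xy]; apply: noxy.
    by exists y, x.
  by exists x, y.
apply: (sub_finite_set _ (finite_set0 R)) => x xJ /=; apply: J0; by exists x.
Qed.

(** A closed discrete set is countable, and a countable finite union of
    intervals is finite. Hence the images of [M] under the coordinates are
    finite. *)
Lemma definable_discrete_finite (M : set 'rV[R]_n) :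
  definable D M -> closed M ->
  (forall a, M a -> \forall x \near a, M x -> x = a) -> finite_set M.
Proof.
move=> dM cM isoM; have ctM := closed_discrete_countable cM isoM.
have finM i : finite_set [set x 0 i | x in M].
  have [s sE] := definable1 (dset_coord_image i dM).
  have E : [set x 0 i | x in M] = \bigcup_(J in [set` s]) [set` J].
    have memE (t : R) : [set x 0 i | x in M] t <->
        [set (const_mx (x 0 i) : 'rV[R]_1) | x in M] (const_mx t).
      split=> [[x Mx <-]|[x Mx E]]; exists x => //.
      by move/rowP/(_ 0): E; rewrite !mxE.
    apply/seteqP; split=> t; first by move/memE; rewrite sE /= => -[J Js];
      rewrite mxE => tJ; exists J.
    by move=> [J Js tJ]; apply/memE; rewrite sE /=; exists J; rewrite ?mxE.
  rewrite E; apply: bigcup_finite; first exact: finite_seq.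
  move=> J Js; apply: countable_interval_finite.
  apply: (sub_countable _ (sub_countable (card_image_le (fun x : 'rV[R]_n => x 0 i) M) ctM)).
  by apply: subset_card_le; rewrite E => t tJ; exists J.
have /finite_seqP[s sE] : finite_set (\bigcup_i [set x 0 i | x in M]).
  by apply: bigcup_finite => [|i _]; [exact: finite_finset | exact: finM].
apply: (@sub_finite_set _ _
  (range (fun c : {ffun 'I_n -> 'I_(size s).+1} => \row_i nth 0 s (c i)))).
  move=> x Mx; exists [ffun i => inord (index (x 0 i) s)] => //.
  apply/rowP => i; rewrite !mxE ffunE.
  have xs : x 0 i \in s.
    have : [set` s] (x 0 i) by rewrite -sE; exists i => //; exists x.
    by [].
  by rewrite inordK ?nth_index // ltnS index_size.
by apply: finite_image; exact: finite_finset.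
Qed.

End Finiteness.

(** * The representation theorem *)

Section Minimizers.
Variables (R : realType) (D : o_minimal_structure R) (n l m : nat).
Variables (f : 'rV[R]_n -> R) (g : 'I_l -> 'rV[R]_n -> R) (h : 'I_m -> 'rV[R]_n -> R).

Lemma definable_minimizers : definable_fun D f ->
  (forall i, definable_fun D (g i)) -> (forall j, definable_fun D (h j)) ->
  definable D [set x | minimizer f g h x].
Proof.
move=> fd gd hd; apply: dset_and; last by apply: dset_eq => //; exact: dfun_cst.
apply: dset_and; apply: dset_all => i; first exact: dset_ge0.
by apply: dset_eq => //; exact: dfun_cst.
Qed.

Lemma closed_minimizers : continuous f -> (forall i, continuous (g i)) ->
  (forall j, continuous (h j)) -> closed [set x | minimizer f g h x].
Proof.
move=> cf cg ch.
have closed_pre (u : 'rV[R]_n -> R) (A : set R) : continuous u -> closed A ->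
    closed [set x | A (u x)].
  by move=> cu cA; apply: (@preimage_closed _ _ u A) => // x _; exact: cu.
rewrite (_ : mkset _ = (\bigcap_i [set x | 0 <= g i x]) `&`
   (\bigcap_j [set x | h j x = 0]) `&` [set x | f x = opt_value f g h]).
  apply: closedI; last exact: (closed_pre f [set y | y = _] cf (@closed_eq _ _)).
  apply: closedI; apply: closed_bigI => i _.
    exact: (closed_pre (g i) [set y | 0 <= y] (cg i) (@closed_ge _ _)).
  exact: (closed_pre (h i) [set y | y = 0] (ch i) (@closed_eq _ _)).
apply/seteqP; split=> x /=.
  by move=> [[gx hx] fx]; split=> //; split=> i _; [exact: gx | exact: hx].
by move=> [[gx hx] fx]; split=> //; split=> i; [exact: gx | exact: hx].
Qed.

Lemma minimum_partial0 (u : 'rV[R]_n -> R) x j : class_C 1 u ->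
  (forall y, u x <= u y) -> partial j u x = 0.
Proof.
move=> uC umin.
have du y : derivable u y (delta_mx 0 j) by case: uC => _ /(_ j) [].
have nmin : \forall y \near x, u x <= u y by near=> y; exact: umin.
exact: (partial_at_min (class_C_is_derive j x uC) du nmin).
Unshelve. all: by end_near. Qed.

End Minimizers.

Theorem theorem4p1 (R : realType) (D : o_minimal_structure R)
    (n l m p : nat) (p_ge3 : (3 <= p)%N)
    (f : 'rV[R]_n -> R)
    (g : 'I_l -> 'rV[R]_n -> R) (h : 'I_m -> 'rV[R]_n -> R)
    (f_def : definable_fun D f) (f_Cp : class_C p f)
    (g_def : forall i, definable_fun D (g i)) (g_Cp : forall i, class_C p (g i))
    (h_def : forall j, definable_fun D (h j)) (h_Cp : forall j, class_C p (h j))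
    (S_neq0 : feasible g h !=set0)
    (f_bounded : has_lbound [set f x | x in feasible g h])
    (f_cond : forall x, minimizer f g h x ->
       [/\ regular_at g h x, strict_complementarity f g h x
         & second_order_sufficiency f g h x]) :
  (exists phi0 phi psi, representation D (p - 2) f g h phi0 phi psi)
  /\
  (forall phi0 phi psi, representation D (p - 2) f g h phi0 phi psi ->
   forall x, minimizer f g h x ->
   [/\ phi0 x = 0 /\ (forall i, phi i x * g i x = 0 /\ 0 <= phi i x),
       gradient f x - \sum_i phi i x *: gradient (g i) x
                    - \sum_j psi j x *: gradient (h j) x = 0
     & forall y, gen_lagrangian f g h phi psi x
                 <= gen_lagrangian f g h phi psi y]).
Proof.
have [k pE] : exists k, p = k.+3.
  by exists (p - 3)%N; rewrite -addn3 subnK.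
have -> : (p - 2)%N = k.+1 by rewrite pE subSS subSS subn0.
subst p; split.
  have fD : def_class D k.+3 f := conj f_def f_Cp.
  have gD i : def_class D k.+3 (g i) := conj (g_def i) (g_Cp i).
  have hD j : def_class D k.+3 (h j) := conj (h_def j) (h_Cp j).
  have low (u : 'rV[R]_n -> R) : def_class D k.+3 u -> def_class D k.+1 u.
    by apply: def_class_leq; rewrite leqW.
  have cert x := fun xmin : minimizer f g h x => let: And3 r c s := f_cond x xmin in
    local_certificate (ltn0Sn k) fD gD hD xmin f_bounded r c s.
  have /finite_seqP[A AE] : finite_set [set x | minimizer f g h x].
    apply: (definable_discrete_finite (definable_minimizers f_def g_def h_def)).
      apply: closed_minimizers; first exact: class_C_continuous f_Cp.
        by move=> i; exact: class_C_continuous (g_Cp i).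
      by move=> j; exact: class_C_continuous (h_Cp j).
    move=> a amin; have [_ isolated] := cert a amin.
    apply: filterS isolated => x xa [xS fx]; apply: contrapT => /eqP /(xa xS).
    by rewrite fx subrr eqxx.
  have Amin x : x \in A <-> minimizer f g h x.
    by rewrite (_ : minimizer f g h x = [set` A] x) // -AE.
  have FD : def_class D k.+1 (fun x => f x - opt_value f g h).
    apply: def_class_sub; first exact: (low f fD).
    exact: def_class_cst.
  have [s0 [s [t [s0P sP tP E]]]] :
      certified D k.+1 (fun x => f x - opt_value f g h) g h (fun=> 1).
    apply: (@certified_glue _ _ _ _ _ _ _ _ _ FD _ _ A).
    - by move=> i; exact: (low _ (gD i)).
    - by move=> j; exact: (low _ (hD j)).
    - by move=> x xS; rewrite subr_ge0; apply: ge_inf => //; exists x.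
    - by move=> x xS /eqP; rewrite subr_eq0 => /eqP fx; apply/Amin.
    - by move=> a /Amin/cert[].
  exists s0, s, t; split=> [|i|j|x].
  - by have [? ?] := sos_def_class s0P.
  - by have [? ?] := sos_def_class (sP i).
  - exact: tP.
  - by rewrite -E mul1r.
move=> phi0 phi psi [[phi0d phi0C phi0s] phiP psiP E] x [[gx hx] fx].
have phi_ge0 i y : 0 <= phi i y by have [_ _ sp] := phiP i; exact: (sos_ge0 y sp).
have phi0_ge0 y : 0 <= phi0 y := sos_ge0 y phi0s.
have term_ge0 i : 0 <= phi i x * g i x by exact: mulr_ge0.
have psi0 : \sum_j psi j x * h j x = 0 by rewrite big1 // => j _; rewrite hx mulr0.
have sum0 : phi0 x + \sum_i phi i x * g i x = 0.
  by have := E x; rewrite fx subrr psi0 addr0.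
have phi00 : phi0 x = 0.
  apply/eqP; rewrite eq_le phi0_ge0 andbT -sum0 lerDl.
  by apply: sumr_ge0.
have phig i : phi i x * g i x = 0.
  move/eqP: sum0; rewrite phi00 add0r psumr_eq0 // => /allP /(_ i).
  by rewrite mem_index_enum => /(_ isT) /eqP.
split.
- by split.
- have lowC (v : 'rV[R]_n -> R) q : class_C q.+1 v -> class_C 1 v by exact: class_C_leq.
  apply/rowP => j; rewrite !mxE !summxE.
  have dphig i : is_derive x (delta_mx 0 j) (fun y => phi i y * g i y)
      (phi i x * partial j (g i) x).
    have [_ /lowC phiC _] := phiP i.
    have dM := is_deriveM (class_C_is_derive j x phiC)
      (class_C_is_derive j x (lowC _ _ (g_Cp i))).
    apply: is_derive_eq dM _; move/eqP: (phig i); rewrite mulf_eq0 => /orP[|] /eqP z.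
      by rewrite (minimum_partial0 j phiC) ?scaler0 ?addr0 // => y; rewrite z.
    by rewrite z scale0r addr0.
  have dpsih i : is_derive x (delta_mx 0 j) (fun y => psi i y * h i y)
      (psi i x * partial j (h i) x).
    have [_ /lowC psiC] := psiP i.
    have dM := is_deriveM (class_C_is_derive j x psiC)
      (class_C_is_derive j x (lowC _ _ (h_Cp i))).
    by apply: is_derive_eq dM _; rewrite hx scale0r addr0.
  have dphi0 : is_derive x (delta_mx 0 j) phi0 0.
    rewrite -(minimum_partial0 (x := x) j (lowC _ _ phi0C)); last first.
      by move=> y; rewrite phi00.
    exact: class_C_is_derive (lowC _ _ phi0C).
  have dR := is_deriveD (is_deriveD dphi0 (is_derive_sumf dphig)) (is_derive_sumf dpsih).
  have dL := is_deriveB (class_C_is_derive j x (lowC _ _ f_Cp))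
    (is_derive_cst (opt_value f g h) x (delta_mx 0 j)).
  have fE : (f - cst (opt_value f g h)) = (fun y => phi0 y + \sum_i phi i y * g i y +
      \sum_i psi i y * h i y) by apply/funext => y; exact: E.
  have : partial j f x - 0 = 0 + \sum_i phi i x * partial j (g i) x +
      \sum_i psi i x * partial j (h i) x.
    by rewrite -(@derive_val _ _ _ _ _ _ _ dL) fE; exact: (@derive_val _ _ _ _ _ _ _ dR).
  rewrite subr0 add0r => ->.
  have gradE (N : nat) (c : 'I_N -> R) (u : 'I_N -> 'rV[R]_n -> R) :
      \sum_i (c i *: gradient (u i) x) 0 j = \sum_i c i * partial j (u i) x.
    by apply: eq_bigr => i _; rewrite !mxE.
  by rewrite !gradE; ring.
- move=> y; have lagE z : gen_lagrangian f g h phi psi z = phi0 z.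
    by rewrite /gen_lagrangian E; ring.
  by rewrite !lagE phi00.
Qed.
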